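(* Let $\mathcal{H}\in C^1([-1,1])$ and suppose that there exists an $\mathcal{H}$-sphere $S_{\mathcal{H}}$ in $\mathbb{S}^2\times\mathbb{R}$. Let $z_1,\dots,z_n$ be the zeros of $\mathcal{H}$, and denote by $m(z_i)$ the multiplicity of $z_i$, $i=1,\dots,n$. Then $\sum_{i=1}^n m(z_i)$ is even.
   Context: $\mathbb{S}^2$ is the unit sphere (curvature $1$). $\mathbb{S}^2\times\mathbb{R}$ carries the product metric, and $\partial_z$ is the unit vertical Killing field, the gradient of the height function (projection onto $\mathbb{R}$). Given $\mathcal{H}\in C^1([-1,1])$, an immersed oriented surface $\Sigma$ in $\mathbb{S}^2\times\mathbb{R}$ with unit normal $\eta$ is an $\mathcal{H}$-surface if its mean curvature $H_\Sigma$ with respect to $\eta$ (half the sum of the principal curvatures) satisfies $H_\Sigma(p)=\mathcal{H}(\nu(p))$ for all $p\in\Sigma$, where $\nu(p)=\langle\eta_p,\partial_z\rangle$ is the angle function. A sphere is a closed (compact, without boundary) immersed surface of genus zero, possibly with self-intersections; an $\mathcal{H}$-sphere is an $\mathcal{H}$-surface that is a sphere. Standing assumption: the (possible) zeros of $\mathcal{H}$ are isolated (hence finitely many) and of finite multiplicity. A zero $z_i$ has multiplicity $m\in\mathbb{N}$, $m\geq1$, if $\mathcal{H}(y)=(y-z_i)^m g(y)$ near $z_i$ with $g$ continuous and $g(z_i)\neq0$; thus $\mathcal{H}$ changes sign at an interior zero exactly when its multiplicity is odd.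
   Formalization: The H-sphere is additionally assumed not to be a horizontal slice S²×{t}: for H(y)=1-y a slice with upward normal is an H-sphere, yet the only zero, 1, has multiplicity 1, so the claim fails as stated. *)

(* Defs.v *)
From HB Require Import structures.
From mathcomp Require Import all_boot all_order all_algebra.
From mathcomp Require Import all_classical all_reals all_analysis.
From mathcomp Require Import ring.

Set Implicit Arguments.
Unset Strict Implicit.
Unset Printing Implicit Defensive.

Import Order.TTheory GRing.Theory Num.Theory.
Import numFieldNormedType.Exports.

Local Open Scope classical_set_scope.
Local Open Scope ring_scope.

(* The library norm on row vectors is the sup norm, hence an explicit
   Euclidean inner product. *)
Definition dot {R : realType} {n : nat} (u v : 'rV[R]_n) : R :=
  \sum_(i < n) u 0 i * v 0 i.

Definition sphere2 {R : realType} : set 'rV[R]_3 := [set p | dot p p = 1].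

(* R^3 x R, in which S^2 x R sits isometrically as sphere2 `*` setT. *)
Notation ambient R := ('rV[R]_3 * R)%type.

Definition inner {R : realType} (v w : ambient R) : R :=
  dot v.1 w.1 + v.2 * w.2.

Definition dz {R : realType} : ambient R := (0, 1).

(* Inverse stereographic projections. stereo false omits only the north pole
   (0, 0, 1) and stereo true only the south pole, so that the two of them form
   an atlas of the standard smooth structure of sphere2. *)
Definition stereo {R : realType} (s : bool) (u : 'rV[R]_2) : 'rV[R]_3 :=
  (dot u u + 1)^-1 *:
    \row_(i < 3) [:: 2 * u 0 0; 2 * u 0 1; (-1) ^+ s * (dot u u - 1)]`_i.

Definition partial {R : realType} {V : normedModType R}
    (f : 'rV[R]_2 -> V) (i : 'I_2) : 'rV[R]_2 -> V :=
  fun u => 'D_(delta_mx 0 i) f u.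

Definition C1_map {R : realType} {V : normedModType R} (f : 'rV[R]_2 -> V) :=
  (forall u, differentiable f u) /\ (forall i, continuous (partial f i)).

Definition C2_map {R : realType} {V : normedModType R} (f : 'rV[R]_2 -> V) :=
  C1_map f /\ (forall i, C1_map (partial f i)).

(* In the next four definitions X is a local parametrization of a surface and
   N its unit normal read in the same parameters. *)
Definition first_form {R : realType} (X : 'rV[R]_2 -> ambient R)
    (u : 'rV[R]_2) : 'M[R]_2 :=
  \matrix_(i, j) inner (partial X i u) (partial X j u).

(* The Levi-Civita connection of S^2 x R is the tangential part of the flat
   one and N is tangent to S^2 x R, so <nabla_{X_i} X_j, N> = <X_ij, N>. *)
Definition second_form {R : realType} (X N : 'rV[R]_2 -> ambient R)
    (u : 'rV[R]_2) : 'M[R]_2 :=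
  \matrix_(i, j) inner (partial (partial X i) j u) (N u).

Definition shape_operator {R : realType} (X N : 'rV[R]_2 -> ambient R)
    (u : 'rV[R]_2) : 'M[R]_2 :=
  invmx (first_form X u) *m second_form X N u.

Definition mean_curvature {R : realType} (X N : 'rV[R]_2 -> ambient R)
    (u : 'rV[R]_2) : R :=
  \tr (shape_operator X N u) / 2.

(* The principal curvatures are the eigenvalues of the shape operator. *)
Lemma mean_curvature_principal (R : realType) (X N : 'rV[R]_2 -> ambient R)
    (u : 'rV[R]_2) (k1 k2 : R) :
  char_poly (shape_operator X N u) = ('X - k1%:P) * ('X - k2%:P) ->
  mean_curvature X N u = (k1 + k2) / 2.
Proof.
move=> E; rewrite /mean_curvature; congr (_ / 2).
have := char_poly_trace (shape_operator X N u) isT.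
have -> : char_poly (shape_operator X N u)
    = 'X^2 - (k1 + k2) *: 'X + (k1 * k2)%:P.
  by rewrite E polyCM -mul_polyC polyCD; ring.
rewrite !coefD coefN coefZ coefXn coefX coefC /= mulr1 add0r addr0.
by move/oppr_inj.
Qed.

(* Immersions of S^2 in S^2 x R and their unit normals. They are total
   functions, of which only the values on sphere2 matter. *)
Record immersed_sphere {R : realType} (psi : 'rV[R]_3 -> ambient R) : Prop := {
  sphere_in_S2xR : forall p, sphere2 p -> sphere2 (psi p).1;
  sphere_C2 : forall s, C2_map (psi \o stereo s);
  sphere_immersion : forall s u, injective ('d (psi \o stereo s) u)
}.

Record unit_normal {R : realType} (psi eta : 'rV[R]_3 -> ambient R) : Prop := {
  normal_continuous : forall s, continuous (eta \o stereo s);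
  normal_unit : forall p, sphere2 p -> inner (eta p) (eta p) = 1;
  normal_tangent_S2xR :
    forall p, sphere2 p -> inner (eta p) ((psi p).1, 0) = 0;
  normal_orthogonal : forall s u i,
    inner (eta (stereo s u)) (partial (psi \o stereo s) i u) = 0
}.

Definition angle {R : realType} (eta : 'rV[R]_3 -> ambient R)
    (p : 'rV[R]_3) : R := inner (eta p) dz.

(* A closed surface of genus zero is diffeomorphic to S^2. *)
Record H_sphere {R : realType} (H : R -> R) (psi eta : 'rV[R]_3 -> ambient R) :
    Prop := {
  H_sphere_immersed : immersed_sphere psi;
  H_sphere_normal : unit_normal psi eta;
  H_sphere_curvature : forall s u,
    mean_curvature (psi \o stereo s) (eta \o stereo s) u
      = H (angle eta (stereo s u))
}.

(* An immersed sphere contained in S^2 x {t} covers it, hence parametrizes the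
   whole slice. It is totally geodesic with angle function 1 or -1, so it is an
   H-sphere as soon as H 1 = 0 or H (-1) = 0, whatever H is elsewhere. *)
Definition horizontal_slice {R : realType} (psi : 'rV[R]_3 -> ambient R) :=
  exists t : R, forall p, sphere2 p -> (psi p).2 = t.

(* C^1([-1, 1]), with one-sided derivatives at the endpoints. *)
Definition C1_on_itv {R : realType} (H : R -> R) :=
  exists2 dH : R -> R, {within `[-1, 1], continuous dH} &
    forall x : R, x \in `[-1, 1] ->
      (H y - H x) / (y - x) @[y --> within `[-1, 1]%classic x^'] --> dH x.

(* The factorization is required on the trace on [-1, 1] of a neighbourhood
   of z, so that zeros at the endpoints are covered. *)
Definition zero_multiplicity {R : realType} (H : R -> R) (z : R) (m : nat) :=
  (0 < m)%N /\
  exists2 e : R, 0 < e & exists g : R -> R,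
    [/\ {within `[-1, 1]%classic `&` ball z e, continuous g}, g z != 0 &
        forall y : R, y \in `[-1, 1] -> ball z e y -> H y = (y - z) ^+ m * g y].

(* Main.v *)
Require Import Defs.
From mathcomp Require Import all_boot all_order all_algebra.
From mathcomp Require Import all_classical all_reals all_analysis.
From mathcomp Require Import ring lra.

(** Why the sum of the multiplicities is even.  The parity of the sum tells
    whether H changes sign between -1 and 1, so it suffices to show that H(-1)
    and H(1) are nonzero and have the same sign ([H_ends_same_sign]); the
    translation into parity is [even_sum_multiplicities], which divides H by
    the product of the powers (y - z_i)^(m_i) and applies the intermediate
    value theorem to the nowhere vanishing quotient.

    The sign of H at the ends of the interval is read at a highest and at a
    lowest point of the sphere.  Let h be the height and nu the angle function.
    The vertical field is parallel, hence the Laplacian of h on the surface is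
    2 H(nu) nu, and its tangential part is the gradient of h, hence
    1 - nu^2 = |grad h|^2.  At an extremum of h the gradient vanishes, so
    nu = 1 or nu = -1, and the sign of the Laplacian gives nu H(nu) <= 0 at a
    maximum and nu H(nu) >= 0 at a minimum.  If both numbers are nonzero, the
    two values of nu are opposite and H(1), H(-1) have the same sign.

    There remains the case H(nu) = 0 at an extremum ([height_extremum]).  Since
    H is C^1 it is Lipschitz at nu = +-1, so near that point |H(nu)| is at most
    a constant times 1 - nu^2 = |grad h|^2.  Thus h satisfies the elliptic
    inequality |Laplacian h| <= C |grad h| there ([trace_dominated]), and the
    strong maximum principle ([strong_minimum_principle]) makes h constant near
    the extremum.  The set of points where h takes its extreme value and nu
    keeps its value is therefore open and closed, so the sphere lies in a slice
    ([slice_of_extremum]), which is excluded.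

    The computations take place in the two stereographic charts, where the
    Laplacian of h, multiplied by the determinant of the first fundamental form,
    is G h_uu - 2 F h_uv + E h_vv up to first order terms. *)

Import Order.TTheory GRing.Theory Num.Theory.
Import numFieldNormedType.Exports.

Local Open Scope classical_set_scope.
Local Open Scope ring_scope.

Set Implicit Arguments.
Unset Strict Implicit.
Unset Printing Implicit Defensive.

(** * Derivatives along lines of the plane *)

Lemma second_derivative_test (R : realType) (f f' : R -> R) (c : R) :
  (\forall t \near (0 : R), f 0 <= f t) ->
  (forall t : R, is_derive t 1 f (f' t)) -> is_derive (0 : R) 1 f' c ->
  f' 0 = 0 /\ 0 <= c.
Proof.
move=> fmin df df'.
have [e /= e0 He] := fmin.
have He' t : `|t| < e -> f 0 <= f t.
  by move=> te; apply: He; rewrite /ball_ /= sub0r normrN.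
have f'0 : f' 0 = 0.
  have d0 : is_derive (0 : R) 1 f 0.
    apply: (@derive1_at_min _ f (- e) e).
    - lra.
    - by move=> t _; case: (df t).
    - by rewrite in_itv /=; apply/andP; split; lra.
    - by move=> t; rewrite in_itv /= -ltr_norml => /He'.
  by case: d0 => _; case: (df 0) => _ -> ->.
split=> //; rewrite leNgt; apply/negP => c0.
(* if c < 0 then f' < 0 just to the right of 0, against the mean value theorem *)
have : h^-1 *: ((f' \o shift 0) (h *: 1) - f' 0) @[h --> (0 : R)^'] --> c.
  case: df' => D E; rewrite -E; exact: D.
move=> /cvgr_lt /(_ 0 c0) [d /= d0 Hd].
have neg h : 0 < h -> h < d -> f' h < 0.
  move=> h0 hd; have := Hd h; rewrite /ball_ /= sub0r normrN gtr0_norm //.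
  move=> /(_ hd); rewrite gt_eqF // => /(_ isT).
  by rewrite f'0 subr0 addr0 /GRing.scale /= mulr1 pmulr_rlt0 ?invr_gt0.
pose b := Num.min d e / 2.
have b0 : 0 < b by rewrite divr_gt0 ?lt_min ?d0 ?e0.
have bde : b < d /\ b < e.
  by split; rewrite /b ltr_pdivrMr // gt_min; apply/orP; [left|right]; lra.
have [|x xb E] := @MVT R f f' 0 b b0 (fun x _ => df x).
  by apply: derivable_within_continuous => t _; case: (df t).
move: xb; rewrite in_itv /= => /andP[x0 xb].
have := He' b; rewrite gtr0_norm // => /(_ bde.2).
have := neg x x0 (lt_trans xb bde.1).
nra.
Qed.

Lemma rV2_decomp (R : realType) (u : 'rV[R]_2) :
  u = u 0 0 *: delta_mx 0 0 + u 0 1 *: delta_mx 0 1.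
Proof.
rewrite [LHS]row_sum_delta !big_ord_recl big_ord0 addr0 /=.
by have -> : lift ord0 ord0 = 1 :> 'I_2 by apply/val_inj.
Qed.

Section Lines.
Context {R : realType}.
Implicit Types (w : 'rV[R]_2 -> R) (u e : 'rV[R]_2).

(** For [p = a ^+ 2], [q = a * b], [r = b ^+ 2] this is the second derivative
    of [w] along [(a, b)]; for the adjugate of a metric it is the principal part
    of the Laplacian, multiplied by the determinant of the metric. *)
Definition second_order (p q r : R) w u : R :=
  p * partial (partial w 0) 0 u
  + q * (partial (partial w 0) 1 u + partial (partial w 1) 0 u)
  + r * partial (partial w 1) 1 u.

Lemma is_derive_line w u e (t : R) : differentiable w (u + t *: e) ->
  is_derive t 1 (fun t : R => w (u + t *: e))
    (e 0 0 * partial w 0 (u + t *: e) + e 0 1 * partial w 1 (u + t *: e)).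
Proof.
move=> dw.
pose L := fun t : R => u + t *: e.
have dL : is_diff t L ( *:%R ^~ e).
  have -> : L = cst u + *:%R ^~ e by [].
  by rewrite -[X in is_diff _ _ X]add0r; apply: is_diffD.
have dL' : differentiable L t by case: dL.
have dwL : differentiable (w \o L) t by exact: differentiable_comp.
split; first exact/derivable1_diffP.
rewrite (deriveE _ dwL) diff_comp //.
rewrite /= diff_val scale1r {1}(rV2_decomp e) linearD !linearZ /=.
by rewrite /partial !deriveE.
Qed.

Lemma is_derive_line2 w u e (t : R) : C2_map w ->
  is_derive t 1
    (fun t : R => e 0 0 * partial w 0 (u + t *: e) + e 0 1 * partial w 1 (u + t *: e))
    (second_order (e 0 0 ^+ 2) (e 0 0 * e 0 1) (e 0 1 ^+ 2) w (u + t *: e)).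
Proof.
move=> [_ w2].
have D i : is_derive t 1 (fun t : R => partial w i (u + t *: e))
    (e 0 0 * partial (partial w i) 0 (u + t *: e)
     + e 0 1 * partial (partial w i) 1 (u + t *: e)).
  by apply: is_derive_line; case: (w2 i) => h _; exact: h.
have D' := is_deriveD (is_deriveZ (e 0 0) (D 0)) (is_deriveZ (e 0 1) (D 1)).
have expand (x y a b a' b' : R) : x * (x * a + y * b) + y * (x * a' + y * b')
    = x ^+ 2 * a + x * y * (b + a') + y ^+ 2 * b' by ring.
by apply: (is_derive_eq D'); exact: expand.
Qed.

End Lines.

(** * The strong minimum principle *)

Section StrongMinimum.
Context {R : realType}.

Definition sqdist (q u : 'rV[R]_2) : R :=
  (u 0 0 - q 0 0) ^+ 2 + (u 0 1 - q 0 1) ^+ 2.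

(** On a line, [sqdist q] is a polynomial [A + 2 B t + E t^2], so this is the
    barrier of [touching_barrier] restricted to a line. *)
Lemma is_derive_barrier (al A B E c k t : R) :
  is_derive t 1
    (fun t : R => c * (expR (- al * (A + 2 * B * t + E * t ^+ 2)) - k))
    (c * (expR (- al * (A + 2 * B * t + E * t ^+ 2)) * (- al * (2 * B + 2 * E * t)))).
Proof.
have D : is_derive t 1 (fun t : R => - al * (A + 2 * B * t + E * t ^+ 2))
    (- al * (2 * B + 2 * E * t)).
  by apply: is_derive_eq; rewrite /GRing.scale /=; ring.
have D2 := is_derive1_comp (is_derive_expR _) D.
have D3 := is_deriveZ c (is_deriveB D2 (is_derive_cst k t 1)).
apply: (is_derive_eq D3); rewrite /GRing.scale /=; move: (expR _) => x; ring.
Qed.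

Lemma is_derive_barrier2 (al A B E c : R) :
  is_derive (0 : R) 1
    (fun t : R =>
       c * (expR (- al * (A + 2 * B * t + E * t ^+ 2)) * (- al * (2 * B + 2 * E * t))))
    (c * expR (- al * A) * (4 * al ^+ 2 * B ^+ 2 - 2 * al * E)).
Proof.
have D : is_derive (0 : R) 1 (fun t : R => - al * (A + 2 * B * t + E * t ^+ 2))
    (- al * (2 * B)).
  by apply: is_derive_eq; rewrite /GRing.scale /=; ring.
have D1 : is_derive (0 : R) 1 (fun t : R => - al * (2 * B + 2 * E * t)) (- al * (2 * E)).
  by apply: is_derive_eq; rewrite /GRing.scale /=; ring.
have D2 := is_derive1_comp (is_derive_expR _) D.
have D3 := is_deriveZ c (is_deriveM D2 D1).
apply: (is_derive_eq D3); rewrite /GRing.scale /= mulr0 addr0 expr0n mulr0 addr0.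
by move: (expR _) => x; ring.
Qed.

(** First and second order conditions where a vertical translate of a multiple
    of the barrier [exp (- al * |. - q|^2) - k] touches the graph of [w] from
    below, obtained by restriction to the lines through the contact point. *)
Lemma touching_barrier (w : 'rV[R]_2 -> R) (q x : 'rV[R]_2) (al c k : R) :
  C2_map w ->
  (\forall u \near x, w x - c * (expR (- al * sqdist q x) - k)
                      <= w u - c * (expR (- al * sqdist q u) - k)) ->
  forall e0 e1 : R,
  let B := (x 0 0 - q 0 0) * e0 + (x 0 1 - q 0 1) * e1 in
  e0 * partial w 0 x + e1 * partial w 1 x
    = - 2 * al * c * expR (- al * sqdist q x) * B /\
  c * expR (- al * sqdist q x) * (4 * al ^+ 2 * B ^+ 2 - 2 * al * (e0 ^+ 2 + e1 ^+ 2))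
    <= second_order (e0 ^+ 2) (e0 * e1) (e1 ^+ 2) w x.
Proof.
move=> w2 xmin e0 e1 B.
pose e : 'rV[R]_2 := e0 *: delta_mx 0 0 + e1 *: delta_mx 0 1.
have E0 : e 0 0 = e0 by rewrite /e !mxE /= mulr1 mulr0 addr0.
have E1 : e 0 1 = e1 by rewrite /e !mxE /= mulr1 mulr0 add0r.
have sE t : sqdist q (x + t *: e)
    = sqdist q x + 2 * B * t + (e0 ^+ 2 + e1 ^+ 2) * t ^+ 2.
  by rewrite /sqdist !mxE -!E0 -!E1 /B !mxE /=; ring.
have dw (t : R) := is_derive_line (w2.1.1 (x + t *: e)).
have dw2 := is_derive_line2 x e 0 w2.
have dg (t : R) := is_derive_barrier al (sqdist q x) B (e0 ^+ 2 + e1 ^+ 2) c k t.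
have dg2 := is_derive_barrier2 al (sqdist q x) B (e0 ^+ 2 + e1 ^+ 2) c.
have D (t : R) := is_deriveB (dw t) (dg t).
have D2 := is_deriveB dw2 dg2.
have [] := @second_derivative_test R _ _ _ _ D D2.
  have cl : (x + t *: e) @[t --> (0 : R)] --> x.
    rewrite -[X in _ --> X]addr0 -[X in _ + X](scale0r e).
    apply: cvgD; first exact: cvg_cst.
    by apply: (@cvgZr_tmp _ _ _ (nbhs (0 : R))); exact: cvg_id.
  have Hc := cl _ xmin.
  near=> t; rewrite !fctE scale0r !addr0 mulr0 expr0n mulr0 !addr0 -sE.
  near: t; exact: Hc.
rewrite !scale0r !addr0 !E0 !E1.
move=> /eqP; rewrite !mulr0 expr0n !mulr0 !addr0 subr_eq0 => /eqP -> H.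
split; first by ring.
by rewrite -subr_ge0.
Unshelve. all: by end_near. Qed.

(** The barrier is a strict subsolution once [al] is large.  For a positive
    definite form [(p, q; q, r)] the trace against a Hessian is, after
    multiplication by [p], the second derivative along [(p, q)] plus
    [p * r - q ^+ 2] times the one along [(0, 1)]; this turns the two directional
    inequalities of [touching_barrier] into one that the differential inequality
    for [w] contradicts.  Here [W0] .. [W11] are the derivatives of [w] at the
    contact point, [(y0, y1)] is its position relative to the centre of the
    barrier and [m] is the value of its exponential part, including the factor. *)
Lemma strict_subsolution_no_contact
    (p q r lam Lam C rho del al m y0 y1 W0 W1 W00 W01 W11 : R) :
  0 < lam -> 0 < al -> 0 < m ->
  (forall a b : R,
     lam * (a ^+ 2 + b ^+ 2) <= p * a ^+ 2 + 2 * q * a * b + r * b ^+ 2) ->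
  p + r <= Lam ->
  W0 = - 2 * al * m * y0 -> W1 = - 2 * al * m * y1 ->
  m * (4 * al ^+ 2 * y1 ^+ 2 - 2 * al) <= W11 ->
  m * (4 * al ^+ 2 * (y0 * p + y1 * q) ^+ 2 - 2 * al * (p ^+ 2 + q ^+ 2))
    <= p ^+ 2 * W00 + p * q * W01 + q ^+ 2 * W11 ->
  p * W00 + q * W01 + r * W11 <= C * (`|W0| + `|W1|) ->
  `|y0| < rho / 2 -> `|y1| < rho / 2 -> del ^+ 2 <= y0 ^+ 2 + y1 ^+ 2 ->
  al * (2 * lam * del ^+ 2) = Lam + 2 * `|C| * rho + 1 -> False.
Proof.
move=> lam0 al0 m0 ell tr EW0 EW1 h1 h2 Ho y0r y1r dels alE.
have p0 : 0 < p by have := ell 1 0; nra.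
have D0 : 0 < p * r - q ^+ 2.
  have := ell (- q) p.
  have -> : p * (- q) ^+ 2 + 2 * q * - q * p + r * p ^+ 2 = p * (p * r - q ^+ 2) by ring.
  move=> H; rewrite -(pmulr_rgt0 _ p0); apply: lt_le_trans H.
  by rewrite mulr_gt0 // ltr_wpDl ?sqr_ge0 ?exprn_gt0.
set form := p * y0 ^+ 2 + 2 * q * y0 * y1 + r * y1 ^+ 2.
have L1 : m * (4 * al ^+ 2 * form - 2 * al * (p + r)) <= p * W00 + q * W01 + r * W11.
  rewrite -(ler_pM2l p0).
  have := ler_wpM2l (ltW D0) h1.
  move: h2; rewrite /form; clear.
  set A := (X in X <= _ -> _); set B := (X in _ <= X -> _) => h2.
  set A' := (X in X <= _ -> _); set B' := (X in _ <= X -> _) => h1.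
  have -> : p * (m * (4 * al ^+ 2 * (p * y0 ^+ 2 + 2 * q * y0 * y1 + r * y1 ^+ 2)
      - 2 * al * (p + r))) = A + A' by rewrite /A /A'; ring.
  have -> : p * (p * W00 + q * W01 + r * W11) = B + B' by rewrite /B /B'; ring.
  exact: lerD.
have L2 : m * (2 * al * (2 * `|C| * rho + 1)) <= m * (4 * al ^+ 2 * form - 2 * al * (p + r)).
  rewrite ler_pM2l //.
  have -> : 2 * al * (2 * `|C| * rho + 1) = 4 * al ^+ 2 * (lam * del ^+ 2) - 2 * al * Lam.
    have -> : 4 * al ^+ 2 * (lam * del ^+ 2) = 2 * al * (al * (2 * lam * del ^+ 2)) by ring.
    by rewrite alE; ring.
  apply: lerB; last by rewrite ler_pM2l // mulr_gt0.
  rewrite ler_pM2l; last by rewrite mulr_gt0 // exprn_gt0.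
  by apply: le_trans (ell _ _); rewrite ler_pM2l.
have L3 : C * (`|W0| + `|W1|) <= m * (2 * al * (`|C| * rho)).
  have -> : `|W0| + `|W1| = m * (2 * al * (`|y0| + `|y1|)).
    rewrite EW0 EW1 !normrM normrN (gtr0_norm al0) (gtr0_norm m0).
    by rewrite (gtr0_norm (_ : 0 < 2)) //; ring.
  have -> : C * (m * (2 * al * (`|y0| + `|y1|))) = m * (2 * al * (C * (`|y0| + `|y1|))).
    by ring.
  rewrite ler_pM2l // ler_pM2l ?mulr_gt0 //.
  apply: (@le_trans _ _ (`|C| * (`|y0| + `|y1|))).
    by rewrite ler_wpM2r ?addr_ge0 // ler_norm.
  by rewrite ler_wpM2l //; lra.
have := le_trans L2 (le_trans L1 (le_trans Ho L3)).
rewrite ler_pM2l // ler_pM2l ?mulr_gt0 //.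
have : 0 <= `|C| * rho.
  by rewrite mulr_ge0 //; have := normr_ge0 y0; lra.
by clear; move: (`|C|) => a; lra.
Qed.

Lemma ltr_norm_sum_sqr (a b d : R) : 0 < d -> a ^+ 2 + b ^+ 2 < d ^+ 2 ->
  `|a| < d /\ `|b| < d.
Proof.
move=> d0 H; rewrite -!sqrtr_sqr -(gtr0_norm d0) -sqrtr_sqr.
have da : 0 < d ^+ 2 by rewrite exprn_gt0.
have := sqr_ge0 a; have := sqr_ge0 b => a0 b0.
by rewrite !ltr_sqrt //; split; lra.
Qed.

Lemma ltr_sqr_norm (a d : R) : `|a| < d -> a ^+ 2 < d ^+ 2.
Proof. by move=> ad; rewrite -(real_normK (num_real a)) ltrXn2r ?nnegrE. Qed.

Lemma sum_sqr_lt_half (a b d : R) : 0 < d -> `|a| < d / 4 -> `|b| < d / 4 ->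
  a ^+ 2 + b ^+ 2 < (d / 2) ^+ 2.
Proof.
move=> d0 /ltr_sqr_norm ha /ltr_sqr_norm hb.
have : 0 < d ^+ 2 by rewrite exprn_gt0.
lra.
Qed.

Lemma ord2P (j : 'I_2) : j = 0 \/ j = 1.
Proof. by case: j => -[|[|//]] p; [left|right]; apply/val_inj. Qed.

Lemma ball_rV2 (x y : 'rV[R]_2) (d : R) : 0 < d ->
  ball x d y <-> `|x 0 0 - y 0 0| < d /\ `|x 0 1 - y 0 1| < d.
Proof.
move=> d0; split=> [[_ H]|[h0 h1]]; first by split; exact: H.
split=> // i j; rewrite (ord1 i) /ball /= /ball_.
by case: (ord2P j) => ->.
Qed.

Definition box (x : 'rV[R]_2) (d : R) : set 'rV[R]_2 :=
  [set y | `|x 0 0 - y 0 0| <= d /\ `|x 0 1 - y 0 1| <= d].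

Lemma compact_box (x : 'rV[R]_2) (d : R) : compact (box x d).
Proof.
have := @rV_compact R 2 (fun i => `[x 0 i - d, x 0 i + d]%classic)
  (fun i => @segment_compact _ _ _).
congr compact; apply/seteqP; split=> y /= H.
  have := H 0; have := H 1; rewrite /= !in_itv /= => /andP[? ?] /andP[? ?].
  by rewrite /box /= !ler_norml; split; apply/andP; split; lra.
case: H; rewrite !ler_norml => /andP[? ?] /andP[? ?].
by move=> i; rewrite in_itv /=; case: (ord2P i) => ->; lra.
Qed.

Lemma continuous_sqdist (q : 'rV[R]_2) : continuous (sqdist q).
Proof.
have sq i : continuous (fun u : 'rV[R]_2 => (u 0 i - q 0 i) ^+ 2).
  move=> u.
  apply: (@continuous_comp _ _ _ (fun u : 'rV[R]_2 => u 0 i - q 0 i) (fun t : R => t ^+ 2)).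
    by apply: continuousB; [exact: coord_continuous|exact: cst_continuous].
  exact: exprn_continuous.
by move=> u; exact: (continuousD (sq 0 u) (sq 1 u)).
Qed.

(** Strong minimum principle for supersolutions of a uniformly elliptic
    operator in nondivergence form with bounded first order terms.  If [w] is
    positive at some [x0] near a zero [u0], compare it with a small multiple of a
    barrier centred at [x0] that vanishes on a circle enclosing [u0]: the
    difference is negative at [u0] but nonnegative on the circle and on a small
    disc around [x0] where [w] is bounded below, so it has an interior minimum
    in between, where a vertical translate of that multiple of the barrier, a
    strict subsolution, touches [w] from below. *)
Lemma strong_minimum_principle (w p q r : 'rV[R]_2 -> R) (lam Lam C : R)
    (u0 : 'rV[R]_2) :
  C2_map w -> 0 < lam ->
  (\forall u \near u0, forall a b : R,
     lam * (a ^+ 2 + b ^+ 2) <= p u * a ^+ 2 + 2 * q u * a * b + r u * b ^+ 2) ->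
  (\forall u \near u0, p u + r u <= Lam) ->
  (\forall u \near u0, second_order (p u) (q u) (r u) w u
                       <= C * (`|partial w 0 u| + `|partial w 1 u|)) ->
  (\forall u \near u0, 0 <= w u) -> w u0 = 0 ->
  \forall u \near u0, w u = 0.
Proof.
move=> w2 lam0 Hell Htr Hop Hw w0.
have [rho rho0 Hrho] : exists2 rho : R, 0 < rho & forall u, ball u0 rho u ->
    [/\ forall a b : R,
          lam * (a ^+ 2 + b ^+ 2) <= p u * a ^+ 2 + 2 * q u * a * b + r u * b ^+ 2,
        p u + r u <= Lam,
        second_order (p u) (q u) (r u) w u <= C * (`|partial w 0 u| + `|partial w 1 u|)
      & 0 <= w u].
  have : \forall u \near u0,
    [/\ forall a b : R,
          lam * (a ^+ 2 + b ^+ 2) <= p u * a ^+ 2 + 2 * q u * a * b + r u * b ^+ 2,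
        p u + r u <= Lam,
        second_order (p u) (q u) (r u) w u <= C * (`|partial w 0 u| + `|partial w 1 u|)
      & 0 <= w u] by near=> u; split; near: u.
  by move=> /nbhs_ballP [d /= d0 Hd]; exists d => // u /Hd.
apply/nbhs_ballP; exists (rho / 4) => /=; first by rewrite divr_gt0.
move=> x0 /ball_rV2 -[|h0 h1]; first by rewrite divr_gt0.
have wc : continuous w by move=> u; apply: differentiable_continuous; exact: w2.1.1.
apply/eqP/negPn/negP => wx0.
have {}wx0 : 0 < w x0.
  rewrite lt_neqAle eq_sym wx0 /=.
  by have [] := Hrho x0 => //; apply/ball_rV2 => //; split; lra.
pose s := sqdist x0.
(* c serves both as a lower bound of w near x0 and, since the barrier is at
   most 1, as the small multiple of the barrier *)
pose c := w x0 / 2.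
have c0 : 0 < c by rewrite divr_gt0.
have [del del0 Hdel] : exists2 del : R, 0 < del & forall u, s u < del ^+ 2 -> c < w u.
  have : \forall u \near x0, c < w u.
    have := cvgr_gt (w x0) (wc x0); apply; rewrite /c; lra.
  move=> /nbhs_ballP [d /= d0 Hd]; exists d => // u su; apply: Hd; apply/ball_rV2 => //.
  by have [] := ltr_norm_sum_sqr d0 su; rewrite ![`|u _ _ - _|]distrC.
have u0b : ball u0 rho u0 by exact: ballxx.
have Lam0 : 0 <= Lam.
  have [He Ht _ _] := Hrho _ u0b.
  by have := He 1 0; have := He 0 1; lra.
(* the value of al that strict_subsolution_no_contact asks for *)
pose al := (Lam + 2 * `|C| * rho + 1) / (2 * lam * del ^+ 2).
have lamdel : 0 < 2 * lam * del ^+ 2 by rewrite !mulr_gt0 // exprn_gt0.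
have al0 : 0 < al.
  apply: divr_gt0 => //; have : 0 <= `|C| * rho by rewrite mulr_ge0 // ltW.
  by clear -Lam0; lra.
have alE : al * (2 * lam * del ^+ 2) = Lam + 2 * `|C| * rho + 1.
  by rewrite divfK // gt_eqF.
pose k := expR (- al * (rho / 2) ^+ 2).
pose v u := expR (- al * s u) - k.
pose K := box u0 (3 * rho / 4).
have cphi : continuous (fun u => w u - c * v u).
  have cc (a : R) : continuous (fun _ : 'rV[R]_2 => a) by exact: cst_continuous.
  have cs : continuous s by exact: continuous_sqdist.
  have cv : continuous v.
    move=> u; have ce : {for u, continuous (fun u => expR (- al * s u))}.
      apply: (@continuous_comp _ _ _ (fun u => - al * s u) expR).
        exact: (continuousM (cc (- al) u) (cs u)).
      exact: continuous_expR.
    exact: (continuousB ce (cc k u)).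
  by move=> u; exact: (continuousB (wc u) (continuousM (cc c u) (cv u))).
have u0K : u0 \in K.
  by rewrite inE /K /box /= !subrr !normr0; split; clear -rho0; lra.
have [x xK xmin] : exists2 x, x \in K &
    forall y, y \in K -> w x - c * v x <= w y - c * v y.
  apply: EVT_min_rV; last exact: continuous_subspaceT.
  - by exists u0; move: u0K; rewrite inE.
  - exact: compact_box.
move: xK; rewrite inE /K /box /= => -[xK0 xK1].
have xb : ball u0 rho x by apply/ball_rV2 => //; clear -rho0 xK0 xK1; split; lra.
have [He Ht Ho wx] := Hrho _ xb.
have vu0 : 0 < v u0.
  rewrite subr_gt0 /k ltr_expR !mulNr ltrN2 ltr_pM2l //.
  exact: sum_sqr_lt_half.
have phix : w x - c * v x < 0.
  by apply: (le_lt_trans (xmin u0 u0K)); rewrite w0 sub0r oppr_lt0 mulr_gt0.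
have vx : 0 < v x.
  by rewrite -(pmulr_rgt0 _ c0); move: (c * v x) phix wx; clear => ? ? ?; lra.
have sx : s x < (rho / 2) ^+ 2.
  by move: vx; rewrite subr_gt0 /k ltr_expR !mulNr ltrN2 ltr_pM2l.
have sx2 : del ^+ 2 <= s x.
  rewrite leNgt; apply/negP => /Hdel cw.
  have : v x <= 1.
    have : expR (- al * s x) <= 1.
      rewrite -expR0 ler_expR mulNr oppr_le0 mulr_ge0 ?(ltW al0) //.
      by rewrite /s /sqdist addr_ge0 ?sqr_ge0.
    rewrite /v; have := expR_gt0 (- al * (rho / 2) ^+ 2); rewrite -/k; clear.
    by move: (expR _) k => ? ?; lra.
  move=> v1; have : c * v x <= c by rewrite ger_pMr.
  by move: (c * v x) phix cw; clear => ? ? ? ?; lra.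
have rho2 : 0 < rho / 2 by rewrite divr_gt0.
have [y0 y1] := ltr_norm_sum_sqr rho2 sx.
(* the minimum over K lies in its interior, because s x < (rho / 2)^2 *)
have xmin' : \forall u \near x, w x - c * (expR (- al * sqdist x0 x) - k)
                                <= w u - c * (expR (- al * sqdist x0 u) - k).
  apply/nbhs_ballP.
  pose m := Num.min (3 * rho / 4 - `|u0 0 0 - x 0 0|) (3 * rho / 4 - `|u0 0 1 - x 0 1|).
  have m0 : 0 < m.
    rewrite lt_min !subr_gt0; clear -h0 h1 y0 y1.
    have := ler_distD (x0 0 0) (u0 0 0) (x 0 0).
    have := ler_distD (x0 0 1) (u0 0 1) (x 0 1).
    by rewrite (distrC (x0 0 0)) (distrC (x0 0 1)) => *; apply/andP; split; lra.
  exists m => //= u /(ball_rV2 _ _ m0); rewrite !lt_min => -[/andP[m00 _] /andP[_ m11]].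
  apply: xmin; rewrite inE /K /box /=; clear -m00 m11; split.
    by have := ler_distD (x 0 0) (u0 0 0) (u 0 0); lra.
  by have := ler_distD (x 0 1) (u0 0 1) (u 0 1); lra.
have touch := touching_barrier w2 xmin'.
have /= [g0 _] := touch 1 0.
have /= [g1 h11] := touch 0 1.
have /= [_ hpq] := touch (p x) (q x).
have m0 : 0 < c * expR (- al * s x) by rewrite mulr_gt0 ?expR_gt0.
move: g0 g1 h11; rewrite /second_order !mul1r !mul0r !mulr0 !mulr1 !addr0 !add0r.
rewrite expr0n expr1n !mul0r !add0r !mul1r !mulr1 => g0 g1 h11.
apply: (strict_subsolution_no_contact lam0 al0 m0 He Ht _ _ h11 hpq Ho y0 y1 sx2 alE).
- by rewrite g0 -!mulrA.
- by rewrite g1 -!mulrA.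
Unshelve. all: by end_near. Qed.

(** The zero multiple of a barrier touches [w] at any local minimum. *)
Lemma second_order_minimum (w : 'rV[R]_2 -> R) (u0 : 'rV[R]_2) :
  C2_map w -> (\forall u \near u0, w u0 <= w u) ->
  [/\ partial w 0 u0 = 0, partial w 1 u0 = 0
    & forall a b : R, 0 <= second_order (a ^+ 2) (a * b) (b ^+ 2) w u0].
Proof.
move=> w2 wmin.
have /(touching_barrier w2) T : \forall u \near u0,
    w u0 - 0 * (expR (- 0 * sqdist 0 u0) - 0) <= w u - 0 * (expR (- 0 * sqdist 0 u) - 0).
  by near=> u; rewrite !mul0r !subr0; near: u.
split.
- by have [+ _] := T 1 0; rewrite mul1r mul0r addr0 => ->; rewrite mulr0 !mul0r.
- by have [+ _] := T 0 1; rewrite mul1r mul0r add0r => ->; rewrite mulr0 !mul0r.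
- by move=> a b; have [_ +] := T a b; rewrite !mul0r.
Unshelve. all: by end_near. Qed.

End StrongMinimum.

(** * The four-dimensional inner product space around S^2 x R *)

Section Ambient.
Context {R : realType}.
Implicit Types (v w : ambient R).

(** The ambient space read as row vectors, to have rank and inverse of
    matrices at hand. *)
Definition flat v : 'rV[R]_(3 + 1) := row_mx v.1 ((v.2)%:M : 'M[R]_1).

Lemma innerE v w : inner v w = (flat v *m (flat w)^T) 0 0.
Proof.
rewrite /inner /flat tr_row_mx mul_row_col mxE; congr (_ + _).
  by rewrite mxE; apply: eq_bigr => k _; rewrite mxE.
by rewrite tr_scalar_mx -scalar_mxM mxE eqxx mulr1n.
Qed.

Lemma flat_inj : injective flat.
Proof.
move=> [a b] [c d] /eq_row_mx /= [-> /matrixP /(_ 0 0)].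
by rewrite !mxE !mulr1n => ->.
Qed.

Lemma flatD v w : flat (v + w) = flat v + flat w.
Proof.
rewrite /flat add_row_mx; congr row_mx.
by apply/matrixP => i j; rewrite !mxE mulrnDl.
Qed.

Lemma flatZ a v : flat (a *: v) = a *: flat v.
Proof.
rewrite /flat scale_row_mx; congr row_mx.
by apply/matrixP => i j; rewrite !mxE mulrnAr.
Qed.

Lemma innerC v w : inner v w = inner w v.
Proof.
by rewrite /inner /dot mulrC; congr (_ + _); apply: eq_bigr => i _; rewrite mulrC.
Qed.

Lemma innerDl v1 v2 w : inner (v1 + v2) w = inner v1 w + inner v2 w.
Proof. by rewrite !innerE flatD mulmxDl mxE. Qed.

Lemma innerZl a v w : inner (a *: v) w = a * inner v w.
Proof. by rewrite !innerE flatZ -scalemxAl mxE. Qed.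

Lemma inner_dz v : inner dz v = v.2.
Proof. by rewrite /inner /dot /= mul1r big1 ?add0r // => i _; rewrite mxE mul0r. Qed.

Lemma inner_ge0 v : 0 <= inner v v.
Proof.
by rewrite /inner /dot addr_ge0 ?sumr_ge0 // => *; rewrite -expr2 sqr_ge0.
Qed.

Lemma inner_eq0 v : inner v v = 0 -> v = 0.
Proof.
case: v => a b; rewrite /inner /= => /eqP; rewrite paddr_eq0 /dot.
- move=> /andP[/eqP a0]; rewrite mulf_eq0 orbb => /eqP ->.
  congr pair; apply/rowP => i; rewrite mxE; apply/eqP.
  have /eqP := psumr_eq0P (fun i _ => sqr_ge0 (a 0 i)) a0 (i := i) isT.
  by rewrite mulf_eq0 orbb.
- by apply: sumr_ge0 => i _; rewrite -expr2 sqr_ge0.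
- by rewrite -expr2 sqr_ge0.
Qed.

Lemma orthogonal_to_frame_eq0 (B : 'I_(3 + 1) -> ambient R) v :
  (forall c : 'I_(3 + 1) -> R, \sum_i c i *: B i = 0 -> forall i, c i = 0) ->
  (forall i, inner (B i) v = 0) -> v = 0.
Proof.
move=> ind ort.
pose M : 'M[R]_(3 + 1) := \matrix_i flat (B i).
have flat0 : flat 0 = 0 by rewrite -(scale0r 0) flatZ scale0r.
have Mu : M \in unitmx.
  rewrite -row_free_unit -kermx_eq0; apply/rowV0P => c /sub_kermxP.
  rewrite mulmx_sum_row => cM.
  have : \sum_i c 0 i *: B i = 0.
    apply: flat_inj; rewrite flat0 -[RHS]cM.
    rewrite (big_morph flat flatD flat0); apply: eq_bigr => i _.
    by rewrite flatZ rowK.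
  by move=> /ind c0; apply/rowP => i; rewrite c0 mxE.
have : M *m (flat v)^T = 0.
  apply/matrixP => i j; rewrite (ord1 j) [RHS]mxE -(ort i) innerE !mxE.
  by apply: eq_bigr => k _; rewrite !mxE.
move=> /(congr1 (mulmx (invmx M))); rewrite mulKmx // mulmx0 => /(congr1 trmx).
by rewrite trmxK trmx0 -flat0 => /flat_inj.
Qed.

(** The vectors [X1], [X2], [N], [(Y, 0)] form a frame of the ambient space, and
    the vertical vector is orthogonal to [(Y, 0)].  Hence, with the determinant
    [D] of the Gram matrix of [X1], [X2] cleared from the denominators,
    [D *: dz] is a combination of [N], [X1], [X2]; the last conclusion is the
    inner product of this combination with [W]. *)
Lemma height_decomposition (Y : 'rV[R]_3) (X1 X2 N : ambient R) :
  dot Y Y = 1 -> inner N N = 1 -> inner N (Y, 0) = 0 ->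
  inner N X1 = 0 -> inner N X2 = 0 -> inner X1 (Y, 0) = 0 -> inner X2 (Y, 0) = 0 ->
  (forall a b : R, a *: X1 + b *: X2 = 0 -> a = 0 /\ b = 0) ->
  let E := inner X1 X1 in let F := inner X1 X2 in let G := inner X2 X2 in
  let D := E * G - F ^+ 2 in
  [/\ 0 < E, 0 < D & forall W : ambient R,
    D * W.2 = D * N.2 * inner W N + (G * X1.2 - F * X2.2) * inner W X1
      + (E * X2.2 - F * X1.2) * inner W X2].
Proof.
move=> Y1 N1 NY NX1 NX2 XY1 XY2 ind E F G D.
have gram a b : inner (a *: X1 + b *: X2) (a *: X1 + b *: X2)
    = a ^+ 2 * E + 2 * a * b * F + b ^+ 2 * G.
  rewrite !(innerDl, innerZl) !(innerC _ (_ + _)) !(innerDl, innerZl).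
  by rewrite (innerC X2 X1) -/E -/F -/G; ring.
have E0 : 0 < E.
  rewrite lt_neqAle inner_ge0 andbT eq_sym; apply/eqP => /inner_eq0 X10.
  have [] := ind 1 0; first by rewrite X10 scaler0 scale0r addr0.
  by move/eqP; rewrite oner_eq0.
have D0 : 0 < D.
  rewrite -(pmulr_rgt0 _ E0).
  have -> : E * D = (- F) ^+ 2 * E + 2 * (- F) * E * F + E ^+ 2 * G by rewrite /D; ring.
  rewrite -gram lt_neqAle inner_ge0 andbT eq_sym; apply/eqP => /inner_eq0 /ind [_ E00].
  by move: E0; rewrite E00 ltxx.
split=> // W.
pose Z : ambient R := D *: dz + (- (D * N.2)) *: N + (- (G * X1.2 - F * X2.2)) *: X1
  + (- (E * X2.2 - F * X1.2)) *: X2.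
have ZE v : inner Z v = D * v.2 - (D * N.2 * inner N v
    + (G * X1.2 - F * X2.2) * inner X1 v + (E * X2.2 - F * X1.2) * inner X2 v).
  by rewrite /Z !(innerDl, innerZl) inner_dz; ring.
have YY : inner (Y, 0) (Y, 0) = 1 by rewrite /inner /= Y1 mulr0 addr0.
pose T : 4.-tuple (ambient R) := [tuple X1; X2; N; (Y, 0) : ambient R].
have Z0 : Z = 0.
  apply: (@orthogonal_to_frame_eq0 (fun i => tnth T i)).
    move=> c; rewrite !big_ord_recl big_ord0 addr0 /= => Hc.
    set c0 := c ord0 in Hc; set c1 := c (lift ord0 ord0) in Hc.
    set c2 := c (lift ord0 (lift ord0 ord0)) in Hc.
    set c3 := c (lift ord0 (lift ord0 (lift ord0 ord0))) in Hc.
    have Hv v : inner (c0 *: X1 + (c1 *: X2 + (c2 *: N + c3 *: ((Y, 0) : ambient R)))) v = 0.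
      have {}Hc : c0 *: X1 + (c1 *: X2 + (c2 *: N + c3 *: ((Y, 0) : ambient R))) = 0 by exact: Hc.
      by rewrite Hc -(scale0r 0) innerZl mul0r.
    have c20 : c2 = 0.
      have := Hv N; rewrite !(innerDl, innerZl) (innerC X1) (innerC X2) NX1 NX2 N1.
      by rewrite (innerC _ N) NY !mulr0 !add0r addr0 mulr1.
    have c30 : c3 = 0.
      have := Hv (Y, 0); rewrite !(innerDl, innerZl) XY1 XY2 NY YY.
      by rewrite !mulr0 !add0r mulr1.
    have [c00 c10] : c0 = 0 /\ c1 = 0.
      apply: ind; apply: inner_eq0.
      by have := Hv (c0 *: X1 + c1 *: X2); rewrite c20 c30 !scale0r !addr0; exact.
    move=> i; case: i => -[|[|[|[|//]]]] p.
    - by rewrite -c00; congr c; apply/val_inj.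
    - by rewrite -c10; congr c; apply/val_inj.
    - by rewrite -c20; congr c; apply/val_inj.
    - by rewrite -c30; congr c; apply/val_inj.
  move=> i; rewrite innerC; case: i => -[|[|[|[|//]]]] p; rewrite (tnth_nth 0) /= ZE.
  - by rewrite NX1 (innerC X2 X1) -/E -/F /D; ring.
  - by rewrite NX2 -/F -/G /D; ring.
  - by rewrite N1 (innerC X1) (innerC X2) NX1 NX2; ring.
  - by rewrite NY XY1 XY2 /=; ring.
have := ZE W; rewrite Z0 -(scale0r 0) innerZl mul0r => /eqP.
by rewrite eq_sym subr_eq0 (innerC N) (innerC X1) (innerC X2) => /eqP.
Qed.

End Ambient.

(** * Differentiability and continuity in a chart *)

Section Smoothness.
Context {R : realType}.

Lemma partial_linear_comp (V W : normedModType R) (f : {linear V -> W})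
    (X : 'rV[R]_2 -> V) i u : continuous f -> differentiable X u ->
  partial (f \o X) i u = f (partial X i u).
Proof.
move=> cf dX; have df := @linear_differentiable _ _ _ f (X u) cf.
rewrite /partial !deriveE //; last exact: differentiable_comp.
by rewrite diff_comp // diff_lin.
Qed.

Lemma partial_linear_compE (V W : normedModType R) (f : {linear V -> W})
    (X : 'rV[R]_2 -> V) i : continuous f -> C1_map X ->
  partial (f \o X) i = f \o partial X i.
Proof. by move=> cf [dX _]; apply/funext => u; rewrite partial_linear_comp. Qed.

Lemma C1_linear_comp (V W : normedModType R) (f : {linear V -> W})
    (X : 'rV[R]_2 -> V) : continuous f -> C1_map X -> C1_map (f \o X).
Proof.
move=> cf X1; have [dX cX] := X1; split=> [u|i].
  by apply: differentiable_comp => //; apply: linear_differentiable.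
rewrite partial_linear_compE // => u.
by apply: continuous_comp; [exact: cX|exact: cf].
Qed.

Lemma C2_linear_comp (V W : normedModType R) (f : {linear V -> W})
    (X : 'rV[R]_2 -> V) : continuous f -> C2_map X -> C2_map (f \o X).
Proof.
move=> cf [X1 X2]; split; first exact: C1_linear_comp.
by move=> i; rewrite partial_linear_compE //; apply: C1_linear_comp.
Qed.

Lemma continuous_fst_ambient : continuous (fst : ambient R -> 'rV[R]_3).
Proof. by move=> x; exact: cvg_fst. Qed.

Lemma continuous_snd_ambient : continuous (snd : ambient R -> R).
Proof. by move=> x; exact: cvg_snd. Qed.

Lemma continuous_inner (A B : 'rV[R]_2 -> ambient R) : continuous A -> continuous B ->
  continuous (fun u => inner (A u) (B u)).
Proof.
move=> cA cB u.
have c1 (C : 'rV[R]_2 -> ambient R) k : continuous C ->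
    {for u, continuous (fun u => (C u).1 0 k)}.
  move=> cC; apply: (@continuous_comp _ _ _ C (fun v : ambient R => v.1 0 k)).
    exact: cC.
  apply: (@continuous_comp _ _ _ fst (fun v : 'rV[R]_3 => v 0 k)).
    exact: continuous_fst_ambient.
  exact: coord_continuous.
have c2 (C : 'rV[R]_2 -> ambient R) : continuous C ->
    {for u, continuous (fun u => (C u).2)}.
  move=> cC; apply: (@continuous_comp _ _ _ C snd); first exact: cC.
  exact: continuous_snd_ambient.
pose j0 : 'I_3 := ord0; pose j1 : 'I_3 := lift ord0 ord0.
pose j2 : 'I_3 := lift ord0 (lift ord0 ord0).
have -> : (fun u => inner (A u) (B u)) = (fun u => (A u).1 0 j0 * (B u).1 0 j0
   + ((A u).1 0 j1 * (B u).1 0 j1 + (A u).1 0 j2 * (B u).1 0 j2) + (A u).2 * (B u).2).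
  by apply/funext => v; rewrite /inner /dot !big_ord_recl big_ord0 addr0.
have cM k := continuousM (c1 A k cA) (c1 B k cB).
exact: (continuousD (continuousD (cM _) (continuousD (cM _) (cM _)))
  (continuousM (c2 A cA) (c2 B cB))).
Qed.

Lemma dot_partial0 (Y : 'rV[R]_2 -> 'rV[R]_3) i u :
  (forall u, differentiable Y u) -> (forall u, dot (Y u) (Y u) = 1) ->
  dot (partial Y i u) (Y u) = 0.
Proof.
move=> dY Y1.
pose v : 'rV[R]_2 := delta_mx 0 i.
have D k : is_derive u v (fun u => Y u 0 k) (partial Y i u 0 k).
  have dY' : derivable Y u v by apply: diff_derivable.
  split; first by move/derivable_mxP: dY'; exact.
  by rewrite /partial derive_mx // mxE.
have D2 k := is_deriveM (D k) (D k).
have D3 := is_derive_sum D2.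
have E : (\sum_(k < 3) ((fun u => Y u 0 k) * (fun u => Y u 0 k))) = cst 1.
  by apply/funext => x; rewrite fct_sumE -[RHS](Y1 x); apply: eq_bigr.
have := derive_val (is_derive := D3); rewrite E derive_cst /GRing.scale /= => /esym H.
suff : 2 * dot (partial Y i u) (Y u) = 0 by clear; lra.
by rewrite -H /dot mulr_sumr; apply: eq_bigr => k _; ring.
Qed.

Lemma partial_affine (f : 'rV[R]_2 -> R) (s k : R) i : (forall u, differentiable f u) ->
  partial (fun u => s * f u - k) i = fun u => s * partial f i u.
Proof.
move=> df; apply/funext => u; pose e : 'rV[R]_2 := delta_mx 0 i.
have D := is_deriveB (is_deriveZ s (derivableP (@diff_derivable _ _ _ f u e (df u))))
  (is_derive_cst k u e).
by rewrite /partial (derive_val (is_derive := D)) subr0.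
Qed.

Lemma partial2_affine (f : 'rV[R]_2 -> R) (s k : R) i j : C2_map f ->
  partial (partial (fun u => s * f u - k) i) j = fun u => s * partial (partial f i) j u.
Proof.
move=> [[df _] c2]; rewrite partial_affine //.
have -> : (fun u => s * partial f i u) = (fun u => s * partial f i u - 0).
  by apply/funext => u; rewrite subr0.
by rewrite partial_affine //; case: (c2 i).
Qed.

Lemma C1_affine (f : 'rV[R]_2 -> R) (s k : R) :
  C1_map f -> C1_map (fun u => s * f u - k).
Proof.
move=> [df cf]; split=> [u|i].
  exact: (differentiableB (differentiableZ s (df u)) (differentiable_cst k u)).
rewrite partial_affine // => u.
have cc : continuous (fun _ : 'rV[R]_2 => s) by exact: cst_continuous.
exact: (continuousM (cc u) (cf i u)).
Qed.

Lemma C2_affine (f : 'rV[R]_2 -> R) (s k : R) :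
  C2_map f -> C2_map (fun u => s * f u - k).
Proof.
move=> [c1 c2]; split; first exact: C1_affine.
move=> i; rewrite partial_affine; last by case: c1.
have -> : (fun u => s * partial f i u) = (fun u => s * partial f i u - 0).
  by apply/funext => u; rewrite subr0.
exact: (C1_affine s 0 (c2 i)).
Qed.

(** [f = O(g)] at [u0], for a nonnegative [g]. *)
Definition dominated (u0 : 'rV[R]_2) (f g : 'rV[R]_2 -> R) :=
  exists C, \forall u \near u0, `|f u| <= C * g u.

Lemma dominatedD (u0 : 'rV[R]_2) f1 f2 g : dominated u0 f1 g -> dominated u0 f2 g ->
  dominated u0 (fun u => f1 u + f2 u) g.
Proof.
move=> [C1 H1] [C2 H2]; exists (C1 + C2); near=> u.
rewrite mulrDl; apply: le_trans (ler_normD _ _) _; apply: lerD; near: u; exact.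
Unshelve. all: by end_near. Qed.

Lemma dominatedM (u0 : 'rV[R]_2) (k f g : 'rV[R]_2 -> R) :
  (forall u, 0 <= g u) -> {for u0, continuous k} -> dominated u0 f g ->
  dominated u0 (fun u => k u * f u) g.
Proof.
move=> g0 ck [C Hf]; exists ((`|k u0| + 1) * `|C|).
have Hk : \forall u \near u0, `|k u| <= `|k u0| + 1.
  by apply: (cvgr_norm_le (k u0) ck); rewrite ltrDl.
near=> u; rewrite normrM -mulrA; apply: ler_pM => //; first by near: u.
apply: (@le_trans _ _ (C * g u)); first by near: u.
by rewrite ler_wpM2r // ler_norm.
Unshelve. all: by end_near. Qed.

Lemma dominated_le (u0 : 'rV[R]_2) (f1 f2 g : 'rV[R]_2 -> R) :
  (\forall u \near u0, `|f1 u| <= `|f2 u|) -> dominated u0 f2 g -> dominated u0 f1 g.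
Proof.
move=> H12 [C H2]; exists C; near=> u; apply: (@le_trans _ _ `|f2 u|); near: u; exact.
Unshelve. all: by end_near. Qed.

End Smoothness.

(** * The elliptic equation for the height function *)

(** What a stereographic chart sees of an H-sphere. *)
Record curvature_chart {R : realType} (H : R -> R) (X N : 'rV[R]_2 -> ambient R) :
    Prop := {
  chart_C2 : C2_map X;
  chart_S2 : forall u, dot (X u).1 (X u).1 = 1;
  chart_immersion : forall u, injective ('d X u);
  chart_normal_continuous : continuous N;
  chart_normal_unit : forall u, inner (N u) (N u) = 1;
  chart_normal_S2 : forall u, inner (N u) ((X u).1, 0) = 0;
  chart_normal_orthogonal : forall u i, inner (N u) (partial X i u) = 0;
  chart_curvature : forall u, mean_curvature X N u = H (N u).2
}.

Section ChartQuantities.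
Context {R : realType}.
Variable X : 'rV[R]_2 -> ambient R.

Definition height : 'rV[R]_2 -> R := snd \o X.

Definition metric_E u := inner (partial X 0 u) (partial X 0 u).
Definition metric_F u := inner (partial X 0 u) (partial X 1 u).
Definition metric_G u := inner (partial X 1 u) (partial X 1 u).
Definition metric_det u := metric_E u * metric_G u - metric_F u ^+ 2.

(** [metric_det] times the trace of the second derivatives of [X] with respect
    to the metric.  Multiplying by the determinant keeps the coefficients
    polynomial. *)
Definition trace_vector u : ambient R :=
  metric_G u *: partial (partial X 0) 0 u
  - metric_F u *: (partial (partial X 0) 1 u + partial (partial X 1) 0 u)
  + metric_E u *: partial (partial X 1) 1 u.

(** [metric_det] times the components of the gradient of the height. *)
Definition height_grad0 u :=
  metric_G u * partial height 0 u - metric_F u * partial height 1 u.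
Definition height_grad1 u :=
  metric_E u * partial height 1 u - metric_F u * partial height 0 u.

Definition grad_size u := `|partial height 0 u| + `|partial height 1 u|.

Lemma grad_size_ge0 u : 0 <= grad_size u.
Proof. by rewrite addr_ge0. Qed.

End ChartQuantities.

Section ScalarIdentities.
Context {R : realType}.

Lemma trace_invmx2 (g S : 'M[R]_2) (e f k : R) :
  g 0 0 = e -> g 0 1 = f -> g 1 0 = f -> g 1 1 = k -> e * k - f ^+ 2 != 0 ->
  (e * k - f ^+ 2) * \tr (invmx g *m S) = k * S 0 0 - f * (S 0 1 + S 1 0) + e * S 1 1.
Proof.
move=> g00 g01 g10 g11 D1.
have l01 : lift ord0 ord0 = 1 :> 'I_2 by apply/val_inj.
pose K : 'M[R]_2 := \matrix_(i, j)
  ((if i == j then if i == 0 then k else e else - f) / (e * k - f ^+ 2)).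
have Kg : K *m g = 1%:M.
  apply/matrixP => i j; rewrite !mxE !big_ord_recl big_ord0 addr0 !mxE l01.
  case: (ord2P i) => ->; case: (ord2P j) => ->;
    by rewrite /= ?g00 ?g01 ?g10 ?g11; field.
have gu : g \in unitmx by have [] := mulmx1_unit Kg.
have -> : invmx g = K by rewrite -[RHS]mulmx1 -(mulmxV gu) mulmxA Kg mul1mx.
rewrite /mxtrace !big_ord_recl big_ord0 addr0 !mxE !big_ord_recl !big_ord0 !addr0.
by rewrite !mxE l01 /=; field.
Qed.

Lemma inner_trace (a b c : R) (v1 v2 v3 v4 n : ambient R) :
  inner (a *: v1 - b *: (v2 + v3) + c *: v4) n
    = a * inner v1 n - b * (inner v2 n + inner v3 n) + c * inner v4 n.
Proof. by rewrite -scaleNr !(innerDl, innerZl) mulNr. Qed.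

Lemma solve_height_equation (a b c d e f g l : R) : a != 0 ->
  a * l = 2 * a ^+ 2 * b * c + f * d + g * e ->
  l = 2 * a * b * c + a^-1 * (d * f + e * g).
Proof. by move=> a0 H; apply: (mulfI a0); rewrite H; field. Qed.

Lemma critical_angle (d n f0 f1 x y : R) : d != 0 ->
  d * (1 - n ^+ 2) = f0 * x + f1 * y -> f0 = 0 -> f1 = 0 -> n ^+ 2 = 1.
Proof.
move=> d0 + f00 f10; rewrite f00 f10 !mul0r addr0 => /eqP.
by rewrite mulf_eq0 (negPf d0) /= subr_eq0 => /eqP <-.
Qed.

Lemma critical_trace (d n k l f0 f1 x y : R) : d != 0 ->
  d * l = 2 * d ^+ 2 * n * k + f0 * x + f1 * y -> f0 = 0 -> f1 = 0 ->
  l = 2 * d * (n * k).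
Proof.
by move=> d0 e f00 f10; apply: (mulfI d0); rewrite e f00 f10; ring.
Qed.

(** Up to the factor [E], the trace of the quadratic form against the adjugate
    of the metric is its value at [(- F, E)] plus a positive multiple of its
    value at [(1, 0)]. *)
Lemma psd_trace_ge0 (E F G W00 W01 W11 : R) : 0 < E -> 0 < E * G - F ^+ 2 ->
  (forall a b : R, 0 <= a ^+ 2 * W00 + a * b * W01 + b ^+ 2 * W11) ->
  0 <= G * W00 + - F * W01 + E * W11.
Proof.
move=> E0 D0 psd; rewrite -(pmulr_rge0 _ E0).
have -> : E * (G * W00 + - F * W01 + E * W11) = (E * G - F ^+ 2) * W00
    + ((- F) ^+ 2 * W00 + - F * E * W01 + E ^+ 2 * W11) by ring.
apply: addr_ge0; last exact: psd.
apply: mulr_ge0; first exact: ltW.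
by have := psd 1 0; rewrite expr1n mul1r mulr0 mul0r expr0n mul0r !addr0.
Qed.

Lemma posdef_trace (e f g : R) : 0 < e -> 0 < e * g - f ^+ 2 -> 0 < e + g.
Proof.
move=> e0 d0; apply: addr_gt0 => //; rewrite -(pmulr_rgt0 _ e0).
by apply: le_lt_trans (sqr_ge0 f) _; rewrite -subr_gt0.
Qed.

(** By Cayley-Hamilton, trace times form minus determinant times square norm
    is the square norm of the image vector; so determinant over trace bounds the
    least eigenvalue from below. *)
Lemma elliptic_estimate (e f g lam : R) : 0 < e + g ->
  lam * (e + g) <= e * g - f ^+ 2 ->
  forall a b : R,
    lam * (a ^+ 2 + b ^+ 2) <= g * a ^+ 2 + 2 * (- f) * a * b + e * b ^+ 2.
Proof.
move=> s0 hl a b; rewrite -(ler_pM2l s0).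
apply: (@le_trans _ _ ((e * g - f ^+ 2) * (a ^+ 2 + b ^+ 2))).
  by rewrite mulrCA mulrA ler_wpM2r // addr_ge0 ?sqr_ge0.
rewrite -subr_ge0.
have -> : (e + g) * (g * a ^+ 2 + 2 * (- f) * a * b + e * b ^+ 2)
    - (e * g - f ^+ 2) * (a ^+ 2 + b ^+ 2) = (g * a - f * b) ^+ 2 + (e * b - f * a) ^+ 2.
  by ring.
by rewrite addr_ge0 ?sqr_ge0.
Qed.

Lemma half_elliptic (d t : R) : 0 < d -> 0 < t -> d / t / 2 * t < d.
Proof.
by move=> d0 t0; rewrite mulrAC divfK ?gt_eqF // ltr_pdivrMr // ltr_pMr // ltr1n.
Qed.

(** Near a unit [n0], [|n - n0|] is controlled by [|1 - n^2|], since the other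
    factor [n + n0] stays away from zero. *)
Lemma dist_unit_le (n n0 : R) : n0 ^+ 2 = 1 -> `|n - n0| < 1 ->
  `|n - n0| <= `|1 - n ^+ 2|.
Proof.
move=> n01 nn0.
have -> : 1 - n ^+ 2 = - (n - n0) * (n + n0) by rewrite -n01; ring.
rewrite normrM normrN ler_peMr //.
have n1 : `|n0| = 1.
  by apply/eqP; rewrite -(@eqrXn2 _ 2) // expr1n real_normK ?num_real // n01.
have -> : n + n0 = 2 * n0 + (n - n0) by ring.
have := lerB_normD (2 * n0) (n - n0).
by rewrite normrM n1 normr_nat; lra.
Qed.

Lemma C1_lipschitz (H : R -> R) (x : R) : C1_on_itv H -> x \in `[-1, 1] ->
  exists2 K : R, 0 <= K & exists2 d : R, 0 < d &
    forall y, y \in `[-1, 1] -> `|y - x| < d -> `|H y - H x| <= K * `|y - x|.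
Proof.
move=> [dH _ dHx] xI; have := dHx x xI => /cvgr_norm_le /(_ (`|dH x| + 1)) [].
  by rewrite ltrDl.
move=> d /= d0 Hd; exists (`|dH x| + 1); first by rewrite addr_ge0.
exists d => // y yI yd.
have [->|yx] := eqVneq y x; first by rewrite !subrr normr0 mulr0.
have := Hd y; rewrite /ball_ /= distrC => /(_ yd yx yI).
by rewrite normf_div ler_pdivrMr // normr_gt0 subr_eq0.
Qed.

End ScalarIdentities.

Section Chart.
Context {R : realType}.
Variables (H : R -> R) (X N : 'rV[R]_2 -> ambient R).
Hypothesis XN : curvature_chart H X N.

Local Notation h := (height X).
Local Notation E := (metric_E X).
Local Notation F := (metric_F X).
Local Notation G := (metric_G X).
Local Notation D := (metric_det X).
Local Notation h0 := (height_grad0 X).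
Local Notation h1 := (height_grad1 X).
Local Notation S := (grad_size X).
Local Notation nu u := (N u).2.

Lemma height_C2 : C2_map h.
Proof.
by apply: (C2_linear_comp (f := snd)); [exact: continuous_snd_ambient|exact: chart_C2 XN].
Qed.

Lemma partial_height i : partial h i = snd \o partial X i.
Proof.
apply: (partial_linear_compE (f := snd)); first exact: continuous_snd_ambient.
exact: (chart_C2 XN).1.
Qed.

Lemma partial2_height i j : partial (partial h i) j = snd \o partial (partial X i) j.
Proof.
rewrite partial_height.
apply: (partial_linear_compE (f := snd)); first exact: continuous_snd_ambient.
exact: (chart_C2 XN).2.
Qed.

Lemma chart_frame u : [/\ 0 < E u, 0 < D u & forall W : ambient R,
  D u * W.2 = D u * nu u * inner W (N u)
    + h0 u * inner W (partial X 0 u) + h1 u * inner W (partial X 1 u)].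
Proof.
rewrite /height_grad0 /height_grad1 !partial_height.
have [[dX _] _] := chart_C2 XN.
have tang i : inner (partial X i u) ((X u).1, 0) = 0.
  rewrite /inner /= mulr0 addr0.
  have := @dot_partial0 R (fst \o X) i u.
  rewrite (partial_linear_comp (f := fst)) //; last exact: continuous_fst_ambient.
  apply; last exact: (chart_S2 XN).
  move=> v; apply: differentiable_comp => //; apply: linear_differentiable.
  exact: continuous_fst_ambient.
apply: (height_decomposition (chart_S2 XN u) (chart_normal_unit XN u)
  (chart_normal_S2 XN u) (chart_normal_orthogonal XN u 0)
  (chart_normal_orthogonal XN u 1) (tang 0) (tang 1)).
move=> a b; rewrite /partial !deriveE // -!linearZ -linearD.
rewrite -[in X in _ = X -> _](linear0 ('d X u)) => /(chart_immersion XN) /matrixP e.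
by have := e 0 0; have := e 0 1; rewrite !mxE /= !mulr1 !mulr0 addr0 add0r.
Qed.

Lemma inner_trace_vector_normal u : inner (trace_vector X u) (N u) = 2 * D u * H (nu u).
Proof.
have [_ D0 _] := chart_frame u.
rewrite -(chart_curvature XN) /mean_curvature /shape_operator.
have FF : inner (partial X 1 u) (partial X 0 u) = F u by exact: innerC.
have D1 : D u != 0 by rewrite gt_eqF.
have /= := @trace_invmx2 R (first_form X u) (second_form X N u) (E u) (F u) (G u)
  _ _ _ _ D1.
rewrite !mxE => /(_ erefl erefl FF erefl) T.
rewrite /trace_vector inner_trace -T (mulrC 2) -mulrA; congr (_ * _).
by rewrite mulrC divfK // pnatr_eq0.
Qed.

Lemma second_order_height u : second_order (G u) (- F u) (E u) h u = (trace_vector X u).2.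
Proof.
rewrite /second_order /trace_vector /= mulNr.
by congr (_ * _ - _ * (_ + _) + _ * _); rewrite partial2_height.
Qed.

(** The Laplacian of the height is [2 * H (nu u) * nu u]: the vertical part of
    [trace_vector], decomposed along the normal, where the mean curvature
    appears, and the tangent vectors, where the gradient of the height appears. *)
Lemma height_equation u :
  D u * (trace_vector X u).2 = 2 * D u ^+ 2 * nu u * H (nu u)
    + h0 u * inner (trace_vector X u) (partial X 0 u)
    + h1 u * inner (trace_vector X u) (partial X 1 u).
Proof.
have [_ _ fr] := chart_frame u.
rewrite fr inner_trace_vector_normal; congr (_ + _ + _).
by move: (D u) (nu u) => a b; ring.
Qed.

(** [1 - nu^2 = |grad h|^2], the squared length of the vertical vector. *)
Lemma angle_equation u :
  D u * (1 - nu u ^+ 2) = h0 u * partial h 0 u + h1 u * partial h 1 u.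
Proof.
have [_ _ /(_ dz)] := chart_frame u.
have e i : partial h i u = (partial X i u).2 by rewrite partial_height.
rewrite !e; move: (D u) (h0 u) (h1 u) (N u) (partial X 0 u) (partial X 1 u).
move=> a b c n x y.
by rewrite !inner_dz mulr1 mulrBr mulr1 => {1}->; ring.
Qed.

Lemma angle_le1 u : `|nu u| <= 1.
Proof.
have := chart_normal_unit XN u; move: (N u) => n; rewrite /inner => n1.
have d0 : 0 <= dot n.1 n.1 by rewrite /dot sumr_ge0 // => i _; rewrite -expr2 sqr_ge0.
by rewrite -(@expr_le1 _ 2) // real_normK ?num_real // -n1 expr2 lerDr.
Qed.

Lemma continuous_angle : continuous (fun u => nu u).
Proof.
move=> u; apply: continuous_comp; first exact: (chart_normal_continuous XN).
exact: continuous_snd_ambient.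
Qed.

Lemma continuous_partial_chart i : continuous (partial X i).
Proof. exact: (chart_C2 XN).1.2. Qed.

Lemma continuous_partial2_chart i j : continuous (partial (partial X i) j).
Proof. by have [_ /(_ i) []] := chart_C2 XN. Qed.

Lemma continuous_metric : [/\ continuous E, continuous F & continuous G].
Proof. by split; apply: continuous_inner; exact: continuous_partial_chart. Qed.

Lemma continuous_metric_det : continuous D.
Proof.
have [cE cF cG] := continuous_metric.
have -> : D = fun u => E u * G u - F u * F u by apply/funext.
by move=> u; exact: (continuousB (continuousM (cE u) (cG u)) (continuousM (cF u) (cF u))).
Qed.

Lemma continuous_trace_vector_tangential i :
  continuous (fun u => inner (trace_vector X u) (partial X i u)).
Proof.
move=> u; have [cE cF cG] := continuous_metric.
pose XX j k v := inner (partial (partial X j) k v) (partial X i v).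
have -> : (fun u => inner (trace_vector X u) (partial X i u)) = fun u =>
    G u * XX 0 0 u - F u * (XX 0 1 u + XX 1 0 u) + E u * XX 1 1 u.
  by apply/funext => v; rewrite inner_trace.
have ci j k := continuous_inner (@continuous_partial2_chart j k)
  (@continuous_partial_chart i).
exact: (continuousD (continuousB (continuousM (cG u) (ci 0 0 u))
  (continuousM (cF u) (continuousD (ci 0 1 u) (ci 1 0 u))))
  (continuousM (cE u) (ci 1 1 u))).
Qed.

Lemma dominated_partial_height i u0 : dominated u0 (partial h i) S.
Proof.
exists 1; near=> u; rewrite mul1r /grad_size.
by case: (ord2P i) => ->; [rewrite lerDl|rewrite lerDr].
Unshelve. all: by end_near. Qed.

Lemma dominated_height_grad0 u0 : dominated u0 h0 S.
Proof.
have [_ cF cG] := continuous_metric; have pos := @grad_size_ge0 R X.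
have -> : h0 = (fun u => G u * partial h 0 u + (- F u) * partial h 1 u).
  by apply/funext => u; rewrite mulNr.
exact: (dominatedD
  (dominatedM pos (cG u0) (@dominated_partial_height 0 u0))
  (dominatedM pos (continuousN (cF u0)) (@dominated_partial_height 1 u0))).
Qed.

Lemma dominated_height_grad1 u0 : dominated u0 h1 S.
Proof.
have [cE cF _] := continuous_metric; have pos := @grad_size_ge0 R X.
have -> : h1 = (fun u => E u * partial h 1 u + (- F u) * partial h 0 u).
  by apply/funext => u; rewrite mulNr.
exact: (dominatedD
  (dominatedM pos (cE u0) (@dominated_partial_height 1 u0))
  (dominatedM pos (continuousN (cF u0)) (@dominated_partial_height 0 u0))).
Qed.

(** Where [H] vanishes at a vertical normal, the zeroth order term of
    [height_equation] is of the order of the gradient too: by the Lipschitz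
    bound [|H (nu u)| <= K * |nu u - nu u0|], which [dist_unit_le] and
    [angle_equation] bound by a quadratic expression in the gradient. *)
Lemma trace_dominated u0 : C1_on_itv H -> H (nu u0) = 0 -> nu u0 ^+ 2 = 1 ->
  dominated u0 (fun u => (trace_vector X u).2) S.
Proof.
move=> HC1 H0 nu1; have pos := @grad_size_ge0 R X.
have D0 u : D u != 0 by have [_ d _] := chart_frame u; rewrite gt_eqF.
pose T i u := inner (trace_vector X u) (partial X i u).
have -> : (fun u => (trace_vector X u).2) = fun u =>
    2 * D u * nu u * H (nu u) + (D u)^-1 * (T 0 u * h0 u + T 1 u * h1 u).
  by apply/funext => u; exact: solve_height_equation (D0 u) (height_equation u).
apply: dominatedD; last first.
  apply: (dominatedM pos); first exact: (continuousV (D0 u0) (@continuous_metric_det u0)).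
  exact: (dominatedD
    (dominatedM pos (@continuous_trace_vector_tangential 0 u0) (@dominated_height_grad0 u0))
    (dominatedM pos (@continuous_trace_vector_tangential 1 u0) (@dominated_height_grad1 u0))).
have nuI u : nu u \in `[-1, 1] by rewrite in_itv /= -ler_norml angle_le1.
have [K K0 [d d0 HK]] := C1_lipschitz HC1 (nuI u0).
rewrite H0 in HK.
apply: (@dominated_le _ _ _
    (fun u => 2 * K * (partial h 0 u * h0 u + partial h 1 u * h1 u))).
  have near_nu : \forall u \near u0, `|nu u - nu u0| < Num.min d 1.
    have md : 0 < Num.min d 1 by rewrite lt_min d0 ltr01.
    exact: (cvgr_distC_lt _ _ (@continuous_angle u0) _ md).
  near=> u.
  have : `|nu u - nu u0| < Num.min d 1 by near: u.
  rewrite lt_min => /andP[nud nud1].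
  have -> : partial h 0 u * h0 u + partial h 1 u * h1 u = D u * (1 - nu u ^+ 2).
    by rewrite angle_equation; congr (_ + _); rewrite mulrC.
  have Dp : 0 < D u by have [_ dd _] := chart_frame u.
  rewrite !normrM (gtr0_norm Dp) (ger0_norm K0) normr_nat.
  have -> : 2 * K * (D u * `|1 - nu u ^+ 2|) = 2 * D u * (K * `|1 - nu u ^+ 2|).
    by move: (D u) `|_| => a b; ring.
  rewrite -mulrA; apply: ler_wpM2l; first by rewrite mulr_ge0 // ltW.
  apply: (@le_trans _ _ (1 * `|H (nu u)|)); first by rewrite ler_wpM2r // angle_le1.
  have := HK _ (nuI u) nud; rewrite mul1r subr0 => Hle; apply: le_trans Hle _.
  by apply: ler_wpM2l => //; exact: dist_unit_le.
have ch i : {for u0, continuous (partial h i)} by have [[_ c] _] := height_C2; exact: c.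
apply: (dominatedM pos); first exact: cst_continuous.
exact: (dominatedD (dominatedM pos (ch 0) (@dominated_height_grad0 u0))
  (dominatedM pos (ch 1) (@dominated_height_grad1 u0))).
Unshelve. all: by end_near. Qed.

(** The sign [s] covers minima ([s = 1]) and maxima ([s = -1]) of the height. *)
Lemma height_extremum (s k : R) u0 : C1_on_itv H -> `|s| = 1 ->
  (forall u, 0 <= s * h u - k) -> s * h u0 - k = 0 ->
  [/\ nu u0 ^+ 2 = 1, 0 <= s * (nu u0 * H (nu u0))
    & H (nu u0) = 0 -> \forall u \near u0, s * h u - k = 0].
Proof.
move=> HC1 s1 wge0 w0.
pose w u := s * h u - k.
have h2 := height_C2.
have w2 : C2_map w by exact: C2_affine.
have dw i u : partial w i u = s * partial h i u.
  by rewrite /w partial_affine //; case: h2 => -[].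
have trw u : second_order (G u) (- F u) (E u) w u = s * (trace_vector X u).2.
  have ddw i j : partial (partial w i) j u = s * partial (partial h i) j u.
    by rewrite /w partial2_affine.
  have scale (p q r w00 w01 w10 w11 h00 h01 h10 h11 : R) :
      w00 = s * h00 -> w01 = s * h01 -> w10 = s * h10 -> w11 = s * h11 ->
      p * w00 + q * (w01 + w10) + r * w11 = s * (p * h00 + q * (h01 + h10) + r * h11).
    by move=> -> -> -> ->; ring.
  rewrite -second_order_height.
  exact: (scale _ _ _ _ _ _ _ _ _ _ _ (ddw 0 0) (ddw 0 1) (ddw 1 0) (ddw 1 1)).
have [g0 g1 psd] : [/\ partial w 0 u0 = 0, partial w 1 u0 = 0
    & forall a b : R, 0 <= second_order (a ^+ 2) (a * b) (b ^+ 2) w u0].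
  by apply: second_order_minimum => //; near=> u; rewrite {1}/w w0; exact: wge0.
have [E0 D0 _] := chart_frame u0.
have Dn0 : D u0 != 0 by rewrite gt_eqF.
have s0 : s != 0 by rewrite -normr_gt0 s1.
have dh0 : partial h 0 u0 = 0 by apply: (mulfI s0); rewrite -dw g0 mulr0.
have dh1 : partial h 1 u0 = 0 by apply: (mulfI s0); rewrite -dw g1 mulr0.
have comb0 (a b x y : R) : x = 0 -> y = 0 -> a * x - b * y = 0.
  by move=> -> ->; rewrite !mulr0 subrr.
have f0 : h0 u0 = 0 by exact: (comb0 _ _ _ _ dh0 dh1).
have f1 : h1 u0 = 0 by exact: (comb0 _ _ _ _ dh1 dh0).
have nu1 : nu u0 ^+ 2 = 1 := critical_angle Dn0 (angle_equation u0) f0 f1.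
split=> //.
  have : 0 <= second_order (G u0) (- F u0) (E u0) w u0 by exact: psd_trace_ge0 E0 D0 psd.
  rewrite trw (critical_trace Dn0 (height_equation u0) f0 f1).
  by rewrite mulrCA pmulr_rge0 // mulr_gt0.
move=> Hnu0.
have [C HC] := trace_dominated HC1 Hnu0 nu1.
have [cE cF cG] := continuous_metric.
have tr0 u : 0 < E u + G u.
  by have [e0 d0 _] := chart_frame u; exact: posdef_trace e0 d0.
pose lam := D u0 / (E u0 + G u0) / 2.
have lam0 : 0 < lam by exact: (divr_gt0 (divr_gt0 D0 (tr0 u0)) (ltr0Sn R 1)).
have elliptic : \forall u \near u0, forall a b : R,
    lam * (a ^+ 2 + b ^+ 2) <= G u * a ^+ 2 + 2 * (- F u) * a * b + E u * b ^+ 2.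
  have : \forall u \near u0, 0 < E u * G u - F u * F u - lam * (E u + G u).
    have cl : {for u0, continuous (fun _ : 'rV[R]_2 => lam)} by exact: cst_continuous.
    have := continuousB
      (continuousB (continuousM (cE u0) (cG u0)) (continuousM (cF u0) (cF u0)))
      (continuousM cl (continuousD (cE u0) (cG u0))).
    move=> /cvgr_gt /(_ 0); apply.
    rewrite -[X in 0 < X]/(D u0 - lam * (E u0 + G u0)) subr_gt0.
    exact: (half_elliptic D0 (tr0 u0)).
  move=> Hnear; near=> u.
  have : 0 < E u * G u - F u * F u - lam * (E u + G u) by near: u; exact: Hnear.
  by rewrite subr_gt0 => /ltW; exact: elliptic_estimate.
have bounded_trace : \forall u \near u0, G u + E u <= G u0 + E u0 + 1.
  have := continuousD (cG u0) (cE u0).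
  by move=> /cvgr_le /(_ (G u0 + E u0 + 1)); apply; rewrite ltrDl.
apply: (strong_minimum_principle w2 lam0 elliptic bounded_trace (C := C)) => //;
  last by near=> u; exact: wge0.
near=> u.
have -> : `|partial w 0 u| + `|partial w 1 u| = S u.
  by congr (_ + _); rewrite dw normrM s1 mul1r.
rewrite trw; apply: le_trans (ler_norm _) _; rewrite normrM s1 mul1r.
by near: u; exact: HC.
Unshelve. all: by end_near. Qed.

End Chart.

(** * The sphere and its two charts *)

Section Sphere.
Context {R : realType}.

Lemma clopen_rV n (A : set 'rV[R]_n) : open A -> closed A -> A !=set0 -> A = setT.
Proof.
move=> oA cA [a Aa]; apply/seteqP; split=> // x _.
pose L (t : R) := a + t *: (x - a).
have cL : continuous L.
  move=> t; have dL : is_diff t L ( *:%R ^~ (x - a)).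
    have -> : L = cst a + *:%R ^~ (x - a) by [].
    by rewrite -[X in is_diff _ _ X]add0r; apply: is_diffD.
  by apply: differentiable_continuous; case: dL.
have conn : connected [set: R] by apply/connected_intervalP.
have BT : L @^-1` A = setT.
  apply: conn.
  - by exists 0; rewrite /= /L scale0r addr0.
  - by exists (L @^-1` A); [apply: open_comp => // t _; exact: cL|rewrite setTI].
  - by exists (L @^-1` A); [apply: preimage_closed => // t _; exact: cL|rewrite setTI].
have : (L @^-1` A) 1 by rewrite BT.
by rewrite /= /L scale1r addrC subrK.
Qed.

Lemma dot2E (u : 'rV[R]_2) : dot u u = u 0 0 ^+ 2 + u 0 1 ^+ 2.
Proof.
rewrite /dot !big_ord_recl big_ord0 addr0.
by have -> : lift ord0 ord0 = 1 :> 'I_2 by apply/val_inj.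
Qed.

Lemma dot3E (u : 'rV[R]_3) : dot u u = u 0 0 ^+ 2 + u 0 1 ^+ 2 + u 0 2 ^+ 2.
Proof.
rewrite /dot !big_ord_recl big_ord0 addr0 addrA.
have -> : lift ord0 ord0 = 1 :> 'I_3 by apply/val_inj.
by have -> : lift ord0 (lift ord0 ord0) = 2 :> 'I_3 by apply/val_inj.
Qed.

Lemma stereoE s (u : 'rV[R]_2) : let d := u 0 0 ^+ 2 + u 0 1 ^+ 2 in
  [/\ stereo s u 0 0 = 2 * u 0 0 / (d + 1), stereo s u 0 1 = 2 * u 0 1 / (d + 1)
    & stereo s u 0 2 = (-1) ^+ s * (d - 1) / (d + 1)].
Proof. by rewrite /stereo dot2E !mxE /=; split; rewrite mulrC. Qed.

Lemma stereo_sphere s (u : 'rV[R]_2) : sphere2 (stereo s u).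
Proof.
rewrite /sphere2 /= dot3E; have [-> -> ->] := stereoE s u.
have : 0 <= u 0 0 ^+ 2 + u 0 1 ^+ 2 by rewrite addr_ge0 ?sqr_ge0.
move: (u 0 0) (u 0 1) => a b d0.
have d1 : a ^+ 2 + b ^+ 2 + 1 != 0 by rewrite gt_eqF // ltr_wpDl.
by rewrite !expr_div_n !exprMn sqrr_sign; field.
Qed.

(** Projecting each closed hemisphere from the opposite pole covers the sphere
    by the images of two compact squares. *)
Lemma stereo_surj (p : 'rV[R]_3) : sphere2 p ->
  exists s u, stereo s u = p /\ (`|u 0 0| <= 1 /\ `|u 0 1| <= 1).
Proof.
rewrite /sphere2 /= dot3E.
pose x := p 0 0; pose y := p 0 1; pose z := p 0 2 => p1.
have {}p1 : x ^+ 2 + y ^+ 2 + z ^+ 2 = 1 by [].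
have [s sz] : exists s : bool, (-1) ^+ s * z <= 0.
  have [z0|z0] := lerP z 0; first by exists false; rewrite expr0 mul1r.
  by exists true; rewrite expr1 mulN1r oppr_le0 ltW.
pose c := 1 - (-1) ^+ s * z.
have c1 : 1 <= c by rewrite /c; lra.
have c0 : c != 0 by rewrite gt_eqF //; lra.
have ss : (-1) ^+ s * (-1) ^+ s = 1 :> R by rewrite -expr2 sqrr_sign.
have dE : (x / c) ^+ 2 + (y / c) ^+ 2 = 2 / c - 1.
  apply: (mulfI (expf_neq0 2 c0)).
  have -> : c ^+ 2 * ((x / c) ^+ 2 + (y / c) ^+ 2) = 1 - z ^+ 2 by rewrite -p1; field.
  have -> : c ^+ 2 * (2 / c - 1) = 2 * c - c ^+ 2 by field.
  rewrite /c; have -> : z ^+ 2 = ((-1) ^+ s * z) ^+ 2.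
    by rewrite exprMn sqrr_sign mul1r.
  by ring.
have d1 : (x / c) ^+ 2 + (y / c) ^+ 2 <= 1.
  by rewrite dE lerBlDr ler_pdivrMr //; lra.
pose u : 'rV[R]_2 := \row_(i < 2) [:: x / c; y / c]`_i.
have u0 : u 0 0 = x / c by rewrite mxE.
have u1 : u 0 1 = y / c by rewrite mxE.
exists s, u; split; last first.
  rewrite u0 u1; split; rewrite -(@expr_le1 _ 2) // real_normK ?num_real //.
    by apply: le_trans d1; rewrite lerDl sqr_ge0.
  by apply: le_trans d1; rewrite lerDr sqr_ge0.
have [e0 e1 e2] := stereoE s u.
move: e0 e1 e2; rewrite u0 u1 dE subrK => e0 e1 e2; apply/rowP => i.
have /or3P : [|| i == 0, i == 1 | i == 2] by case: i => -[|[|[|]]].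
case=> /eqP ->.
- by rewrite e0 -/x; field.
- by rewrite e1 -/y; field.
- rewrite e2 -/z.
  have -> : (-1) ^+ s * (2 / c - 1 - 1) / (2 / c) = (-1) ^+ s * (1 - c) by field.
  by rewrite /c subKr mulrA ss mul1r.
Qed.

Lemma stereo_overlap : exists u : 'rV[R]_2, stereo false u = stereo true u.
Proof.
exists (delta_mx 0 0); rewrite /stereo; congr (_ *: _); apply/rowP => i; rewrite !mxE.
by rewrite dot2E !mxE /= expr1n expr0n /= addr0 subrr !mulr0.
Qed.

Lemma sphere_max (f : 'rV[R]_3 -> R) : (forall s, continuous (f \o stereo s)) ->
  exists2 p, sphere2 p & forall q, sphere2 q -> f q <= f p.
Proof.
move=> cf; pose K : set 'rV[R]_2 := box 0 1.
have max s : exists u, forall v, K v -> f (stereo s v) <= f (stereo s u).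
  have [u _ um] : exists2 u, u \in K & forall v, v \in K -> f (stereo s v) <= f (stereo s u).
    apply: (EVT_max_rV (f := f \o stereo s)); last exact: continuous_subspaceT.
    - by exists 0; rewrite /K /box /= !subrr !normr0.
    - exact: compact_box.
  by exists u => v Kv; apply: um; rewrite inE.
have unit_box (u : 'rV[R]_2) : `|u 0 0| <= 1 -> `|u 0 1| <= 1 -> K u.
  by move=> k0 k1; rewrite /K /box /= !mxE !sub0r !normrN.
have [u0 h0] := max false; have [u1 h1] := max true.
have [u01|u10] := lerP (f (stereo false u0)) (f (stereo true u1)).
  exists (stereo true u1); first exact: stereo_sphere.
  move=> q /stereo_surj [s [u [<- [k0 k1]]]]; have Ku := unit_box u k0 k1.
  by case: s; [exact: h1|exact: (le_trans (h0 _ Ku))].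
exists (stereo false u0); first exact: stereo_sphere.
move=> q /stereo_surj [s [u [<- [k0 k1]]]]; have Ku := unit_box u k0 k1.
by case: s; [exact: (le_trans (h1 _ Ku) (ltW u10))|exact: h0].
Qed.

Variables (H : R -> R) (psi eta : 'rV[R]_3 -> ambient R).
Hypotheses (HC1 : C1_on_itv H) (S : H_sphere H psi eta).

Lemma H_sphere_chart s : curvature_chart H (psi \o stereo s) (eta \o stereo s).
Proof.
case: S => -[sph C2 imm] [cont unit tang orth] curv; split=> //.
- by move=> u; apply: sph; exact: stereo_sphere.
- by move=> u; apply: unit; exact: stereo_sphere.
- by move=> u; apply: tang; exact: stereo_sphere.
- by move=> u i; exact: orth.
- by move=> u; rewrite curv /angle innerC inner_dz.
Qed.

(** The points where the height has its extreme value and the angle function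
    the value at [p0] form a set that is closed by continuity and, in each chart,
    open by [height_extremum]; keeping the angle function fixed in the definition
    is what makes [H] vanish at all of them.  The two charts overlap, so this set
    is the whole sphere. *)
Lemma slice_of_extremum (s k : R) p0 : `|s| = 1 ->
  (forall p, sphere2 p -> 0 <= s * (psi p).2 - k) ->
  sphere2 p0 -> s * (psi p0).2 - k = 0 -> H (eta p0).2 = 0 -> horizontal_slice psi.
Proof.
move=> s1 ge0 p0S p0k H0.
pose A b := [set u | s * (psi (stereo b u)).2 - k = 0
                     /\ (eta (stereo b u)).2 = (eta p0).2].
have ext b u (e0 : s * (psi (stereo b u)).2 - k = 0) :=
  height_extremum (H_sphere_chart b) HC1 s1 (fun v => ge0 _ (stereo_sphere b v)) e0.
have cnu b : continuous (fun u => (eta (stereo b u)).2).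
  exact: (continuous_angle (H_sphere_chart b)).
have ch b : continuous (fun u => s * (psi (stereo b u)).2 - k).
  move=> u; apply: differentiable_continuous.
  by have [[d _] _] := C2_affine s k (height_C2 (H_sphere_chart b)); exact: d.
have AT b : A b !=set0 -> A b = setT.
  apply: clopen_rV.
    rewrite openE => u [e0 e1].
    have [nu1 _ ]:= ext b u e0; rewrite /= e1 => /(_ H0) near0.
    have near1 : \forall v \near u, `|(eta (stereo b v)).2 - (eta (stereo b u)).2| < 1.
      exact: (cvgr_distC_lt _ _ (cnu b u) _ ltr01).
    rewrite /interior; near=> v.
    have v0 : s * (psi (stereo b v)).2 - k = 0 by near: v.
    split=> //; rewrite -e1.
    have [nuv _ _] := ext b v v0.
    have : `|(eta (stereo b v)).2 - (eta (stereo b u)).2| < 1 by near: v.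
    (* both values are 1 or -1, and they differ by less than 1 *)
    move: nu1 nuv => /=; move: (eta (stereo b v)).2 (eta (stereo b u)).2 => x y.
    move=> /eqP + /eqP; rewrite !sqrf_eq1 => /orP[]/eqP-> /orP[]/eqP-> //;
      rewrite ltr_norml => /andP[]; lra.
  have -> : A b = (fun u => s * (psi (stereo b u)).2 - k) @^-1` [set 0] `&`
                 (fun u => (eta (stereo b u)).2) @^-1` [set (eta p0).2] by [].
  apply: closedI.
    by apply: preimage_closed => [u _|]; [exact: ch|exact: closed_eq].
  by apply: preimage_closed => [u _|]; [exact: cnu|exact: closed_eq].
have [b [u [E _]]] := stereo_surj p0S.
have Ab : A b = setT by apply: AT; exists u; rewrite /A /= E.
have [v ov] := stereo_overlap.
have Aall b' : A b' = setT.
  apply: AT; exists v.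
  have -> : A b' v = A b v by rewrite /A /=; case: b {E Ab}; case: b'; rewrite ?ov.
  by rewrite Ab.
have s0 : s != 0 by rewrite -normr_gt0 s1.
exists (k / s) => p /stereo_surj [b' [w [<- _]]].
have : A b' w by rewrite Aall.
case=> /eqP; rewrite subr_eq0 => /eqP <- _.
by rewrite mulrAC divff // mul1r.
Unshelve. all: by end_near. Qed.

Lemma H_ends_same_sign : ~ horizontal_slice psi -> 0 < H 1 * H (-1).
Proof.
move=> nslice.
have ch b : continuous ((snd \o psi) \o stereo b).
  move=> u; apply: differentiable_continuous.
  exact: (height_C2 (H_sphere_chart b)).1.1.
have chN b : continuous ((fun p => - (psi p).2) \o stereo b).
  by move=> u; exact: (continuousN (ch b u)).
have [p pS pmax] := sphere_max ch.
have [q qS qmax] := sphere_max chN.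
have geN x : sphere2 x -> 0 <= -1 * (psi x).2 - (- (psi p).2).
  by move=> /pmax /= xp; rewrite mulN1r opprK addrC subr_ge0.
have ge1 x : sphere2 x -> 0 <= 1 * (psi x).2 - (psi q).2.
  by move=> /qmax; rewrite mul1r subr_ge0 lerN2.
have pe : -1 * (psi p).2 - (- (psi p).2) = 0 by rewrite mulN1r subrr.
have qe : 1 * (psi q).2 - (psi q).2 = 0 by rewrite mul1r subrr.
have n1 : `|-1 : R| = 1 by rewrite normrN normr1.
have Hp : H (eta p).2 != 0.
  by apply/eqP => h; apply: nslice; exact: slice_of_extremum n1 geN pS pe h.
have Hq : H (eta q).2 != 0.
  by apply/eqP => h; apply: nslice; exact: slice_of_extremum (normr1 R) ge1 qS qe h.
have [b [u [Ep _]]] := stereo_surj pS.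
have [c [v [Eq _]]] := stereo_surj qS.
subst p q.
have [] := height_extremum (H_sphere_chart b) HC1 n1
  (fun v => geN _ (stereo_sphere b v)) pe.
have [] := height_extremum (H_sphere_chart c) HC1 (normr1 R)
  (fun v => ge1 _ (stereo_sphere c v)) qe.
move: Hp Hq; rewrite /=.
move: (eta (stereo b u)).2 (eta (stereo c v)).2.
move=> x y Hx Hy /eqP y1 Hy' _ /eqP x1 Hx' _.
move: x1 y1; rewrite !sqrf_eq1 => /orP[]/eqP ? /orP[]/eqP ?; subst x y.
- by exfalso; move/eqP: Hx; apply; lra.
- have H1 : H 1 < 0 by rewrite lt_neqAle Hx /=; lra.
  have H2 : H (-1) < 0 by rewrite lt_neqAle Hy /=; lra.
  by rewrite nmulr_rgt0.
- by apply: mulr_gt0; rewrite lt_neqAle eq_sym ?Hx ?Hy /=; lra.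
- by exfalso; move/eqP: Hx; apply; lra.
Qed.

End Sphere.

(** * Parity of the zeros of a function on [-1, 1] *)

Section Parity.
Context {R : realType}.

Lemma C1_continuous (H : R -> R) (x : R) : C1_on_itv H -> x \in `[-1, 1] ->
  H y @[y --> within `[-1, 1]%classic (nbhs x)] --> H x.
Proof.
move=> HC1 xI; have [K K0 [d d0 HK]] := C1_lipschitz HC1 xI.
apply/cvgrPdist_lt => e e0.
have K1 : 0 < K + 1 by rewrite ltr_wpDl.
have del0 : 0 < Num.min d (e / (K + 1)) by rewrite lt_min d0 divr_gt0.
have near_x := nbhsx_ballx x _ del0.
suff : \forall y \near x, `[-1, 1]%classic y -> `|H x - H y| < e by [].
near=> y => yI.
have : ball x (Num.min d (e / (K + 1))) y by near: y.
rewrite /ball /= distrC lt_min => /andP[yd ye].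
rewrite distrC; apply: le_lt_trans (HK y yI yd) _.
rewrite ltr_pdivlMr // in ye; apply: le_lt_trans ye.
by rewrite mulrC ler_wpM2l // lerDl.
Unshelve. all: by end_near. Qed.

Lemma continuous_root_product n (z : 'I_n -> R) (m : 'I_n -> nat) (P : pred 'I_n) :
  continuous (fun y => \prod_(i | P i) (y - z i) ^+ m i).
Proof.
have -> : (fun y => \prod_(i | P i) (y - z i) ^+ m i)
    = horner (\prod_(i | P i) ('X - (z i)%:P) ^+ m i).
  apply/funext => y; rewrite horner_prod; apply: eq_bigr => i _.
  by rewrite horner_exp hornerXsubC.
exact: continuous_horner.
Qed.

Lemma root_product_neq0 n (z : 'I_n -> R) (m : 'I_n -> nat) (P : pred 'I_n) y :
  (forall i, P i -> y != z i) -> \prod_(i | P i) (y - z i) ^+ m i != 0.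
Proof.
by move=> h; apply/prodf_neq0 => i /h yz; rewrite expf_neq0 // subr_eq0.
Qed.

Lemma near_neq_roots n (z : 'I_n -> R) (P : pred 'I_n) (x : R) :
  (forall i, P i -> x != z i) -> \forall y \near x, forall i, P i -> y != z i.
Proof.
move=> h.
apply: (@filter_forall R 'I_n (fun i y => P i -> y != z i) (nbhs x) _) => i.
have [Pi|nPi] := boolP (P i); last by near=> y.
have xz : 0 < `|x - z i| by rewrite normr_gt0 subr_eq0 h.
have hb := nbhsx_ballx x _ xz.
near=> y; move=> _; apply/eqP => yz.
have : ball x `|x - z i| y by near: y.
by rewrite yz /ball /= ltxx.
Unshelve. all: by end_near. Qed.

(** The quotient [G] of [H] by the product of the [(y - z i) ^+ m i] extends
    continuously to the zeros, where the factorizations given by the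
    multiplicities show that it does not vanish; so it has constant sign on
    [-1, 1].  The product is positive at 1 and has the sign of
    [(-1) ^+ \sum_i m i] at -1. *)
Lemma even_sum_multiplicities (H : R -> R) n (z : 'I_n -> R) (m : 'I_n -> nat) :
  (forall x : R, x \in `[-1, 1] ->
     H y @[y --> within `[-1, 1]%classic (nbhs x)] --> H x) ->
  injective z ->
  (forall x : R, (x \in `[-1, 1] /\ H x = 0) <-> exists i, z i = x) ->
  (forall i, zero_multiplicity H (z i) (m i)) -> 0 < H 1 * H (-1) ->
  ~~ odd (\sum_(i < n) m i)%N.
Proof.
move=> Hc z_inj zeros mult Hends; apply/negP => oddm.
pose W x := within `[-1, 1]%classic (nbhs (x : R)).
pose P y := \prod_i (y - z i) ^+ m i.
pose Q i y := \prod_(j | j != i) (y - z j) ^+ m j.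
have PQ i y : P y = (y - z i) ^+ m i * Q i y by rewrite /P (bigD1 i).
have zI i : z i \in `[-1, 1] by have [] := (zeros (z i)).2 (ex_intro _ i erefl).
have zH i : H (z i) = 0 by have [] := (zeros (z i)).2 (ex_intro _ i erefl).
have /choice [g gP] : forall i, exists g : R -> R,
    [/\ g x @[x --> W (z i)] --> g (z i), g (z i) != 0
      & \forall y \near W (z i), H y = (y - z i) ^+ m i * g y].
  move=> i; have [_ [e e0 [g [cg g0 Hg]]]] := mult i; exists g.
  have eb := nbhsx_ballx (z i) e e0.
  split=> //.
    have /subspace_continuousP /(_ (z i)) := cg.
    move=> /(_ (conj (zI i) (ballxx _ e0))) cg'.
    apply: cvg_trans cg'; apply: cvg_fmap2 => A HA.
    have HA' : \forall y \near z i, (`[-1, 1]%classic `&` ball (z i) e) y -> A y.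
      exact: HA.
    suff : \forall y \near z i, `[-1, 1]%classic y -> A y by [].
    near=> y => yI.
    have HAy : (`[-1, 1]%classic `&` ball (z i) e) y -> A y by near: y.
    by apply: HAy; split => //; near: y.
  suff : \forall y \near z i, `[-1, 1]%classic y -> H y = (y - z i) ^+ m i * g y by [].
  by near=> y => yI; apply: Hg => //; near: y.
pose G y := if [pick i | z i == y] is Some i then g i y / Q i y else H y / P y.
have Gz i y : z i = y -> G y = g i y / Q i y.
  move=> zy; rewrite /G; case: pickP => [j /eqP|/(_ i)]; last by rewrite zy eqxx.
  by rewrite -zy => /z_inj ->.
have Gn y : (forall i, y != z i) -> G y = H y / P y.
  by move=> yz; rewrite /G; case: pickP => // j /eqP zy; have := yz j; rewrite zy eqxx.
have Qz i : Q i (z i) != 0.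
  by apply: root_product_neq0 => j ji; rewrite (inj_eq z_inj) eq_sym.
have Pn y : (forall i, y != z i) -> P y != 0 by move=> h; apply: root_product_neq0.
have Hn y : y \in `[-1, 1] -> (forall i, y != z i) -> H y != 0.
  move=> yI yz; apply/eqP => H0; have [i zy] := (zeros y).1 (conj yI H0).
  by have := yz i; rewrite zy eqxx.
have dich y : (exists i, z i = y) \/ (forall i, y != z i).
  have [[i zy]|h] := pselect (exists i, z i = y); first by left; exists i.
  by right => i; apply/eqP => e; apply: h; exists i.
have G0 y : y \in `[-1, 1] -> G y != 0.
  move=> yI; have [[i zy]|yz] := dich y.
    rewrite (Gz i) // -zy; have [_ g0 _] := gP i.
    by rewrite mulf_neq0 ?invr_neq0.
  by rewrite Gn // mulf_neq0 ?invr_neq0 ?Pn ?Hn.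
have Gc : {within `[-1, 1]%classic, continuous G}.
  apply/subspace_continuousP => x xI; change (G y @[y --> W x] --> G x).
  have [[i zx]|xz] := dich x.
    subst x; have [cg g0 Hg] := gP i; rewrite (Gz i) //.
    have c : g i y / Q i y @[y --> W (z i)] --> g i (z i) / Q i (z i).
      apply: cvgM => //; apply: cvgV => //.
      by apply: cvg_within_filter; exact: continuous_root_product.
    apply: cvg_trans c; apply: near_eq_cvg.
    have nz : \forall y \near W (z i), forall j, j != i -> y != z j.
      apply: cvg_within; apply: near_neq_roots => j ji.
      by rewrite (inj_eq z_inj) eq_sym.
    near=> y.
    have [->|yz] := eqVneq y (z i); first by rewrite (Gz i).
    have yzz j : y != z j.
      by have [->//|ji] := eqVneq j i; move: j ji; near: y.
    rewrite Gn // (PQ i); have -> : H y = (y - z i) ^+ m i * g i y by near: y.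
    rewrite invfM mulrACA divff ?mul1r //.
    by rewrite expf_neq0 // subr_eq0.
  rewrite Gn //.
  have c : H y / P y @[y --> W x] --> H x / P x.
    apply: cvgM; first exact: Hc.
    apply: cvgV; first exact: Pn.
    by apply: cvg_within_filter; exact: continuous_root_product.
  apply: cvg_trans c; apply: near_eq_cvg.
  have nz : \forall y \near W x, forall j, true -> y != z j.
    by apply: cvg_within; apply: near_neq_roots => j _.
  by near=> y; rewrite Gn // => j; move: j isT; near: y.
have I1 : (1 : R) \in `[-1, 1] by rewrite in_itv /= lexx andbT; lra.
have IN1 : (-1 : R) \in `[-1, 1] by rewrite in_itv /= lexx /=; lra.
have [H1 HN1] : H 1 != 0 /\ H (-1) != 0.
  by split; apply: contraTneq Hends => ->; rewrite ?mul0r ?mulr0 ltxx.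
have z1 i : 1 != z i by apply: contraNneq H1 => ->; rewrite zH.
have zN1 i : -1 != z i by apply: contraNneq HN1 => ->; rewrite zH.
have P1 : 0 < P 1.
  apply: prodr_gt0 => i _; rewrite exprn_gt0 // subr_gt0 lt_neqAle eq_sym z1 /=.
  by have := zI i; rewrite in_itv /= => /andP[].
have PN1 : P (-1) < 0.
  have -> : P (-1) = - \prod_i (z i + 1) ^+ m i.
    have -> : P (-1) = \prod_i ((-1) ^+ m i * (z i + 1) ^+ m i).
      by apply: eq_bigr => i _; rewrite -exprMn; congr (_ ^+ _); ring.
    by rewrite big_split /= -expr_sum -signr_odd oddm expr1 mulN1r.
  rewrite oppr_lt0; apply: prodr_gt0 => i _; rewrite exprn_gt0 //.
  have := zI i; rewrite in_itv /= => /andP[h _].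
  have : -1 < z i by rewrite lt_neqAle zN1.
  by lra.
have GG : G (-1) * G 1 < 0.
  rewrite !Gn // mulrACA pmulr_rlt0; last by rewrite mulrC.
  by rewrite pmulr_llt0 ?invr_gt0 // invr_lt0.
have [c cI Gc0] : exists2 c, c \in `[-1, 1] & G c = 0.
  have le1 : (-1 : R) <= 1 by lra.
  apply: (IVT le1 Gc).
  rewrite ge_min le_max; have [g1|g1] := ltrP 0 (G 1).
    by move: GG; rewrite pmulr_llt0 // => /ltW ->; rewrite (ltW g1) orbT.
  rewrite orbT /=; apply/orP; left; rewrite leNgt; apply/negP => gN.
  by move: GG; rewrite nmulr_rlt0 // ltNge g1.
by have := G0 c cI; rewrite Gc0 eqxx.
Unshelve. all: by end_near. Qed.

End Parity.

Theorem proposition3p8 (R : realType) (H : R -> R) (n : nat)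
    (z : 'I_n -> R) (m : 'I_n -> nat)
    (H_C1 : C1_on_itv H)
    (z_inj : injective z)
    (z_zeros : forall x : R, (x \in `[-1, 1] /\ H x = 0) <-> exists i, z i = x)
    (m_mult : forall i, zero_multiplicity H (z i) (m i))
    (S_H : exists psi eta : 'rV[R]_3 -> 'rV[R]_3 * R,
       H_sphere H psi eta /\ ~ horizontal_slice psi) :
  ~~ odd (\sum_(i < n) m i)%N.
Proof.
have [psi [eta [S nslice]]] := S_H.
apply: (even_sum_multiplicities (H := H) (z := z)) => //.
  by move=> x; exact: C1_continuous.
exact: (H_ends_same_sign H_C1 S nslice).
Qed.
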